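(* Let $\nu(u)$ and $\mu(u)$ be smooth functions on an interval $J\subset\mathbb R$ satisfying $$\mu>0,\quad \nu\neq0,\quad \mu^2\ne\nu^2,\quad |\mu^2-\nu^2|_u\neq0,\quad \Big|\frac{\mu+\nu}{\mu-\nu}\Big|_u\neq0,$$ $$\tfrac14\big(\ln|\mu^2-\nu^2|\big)_{uu}-\tfrac1{16}\big(\ln|\mu^2-\nu^2|\big)_u^2+\nu^2+\mu^2=0,$$ $$\tfrac12\Big(\ln\Big|\frac{\mu+\nu}{\mu-\nu}\Big|\Big)_{uu}-\tfrac18\big(\ln|\mu^2-\nu^2|\big)_u\Big(\ln\Big|\frac{\mu+\nu}{\mu-\nu}\Big|\Big)_u+2\nu\mu=0 .$$ Then there exists a unique up to a rigid motion of $\mathbb R^4$ minimal surface of general type $M^2: z=z(u,v)$, $(u,v)\in\mathcal D_0=J\times J'$ for some interval $J'\subset\mathbb R$, satisfying $\gamma_1=0$, with invariants $\nu(u)$ and $\mu(u)$; furthermore $(u,v)$ are canonical parameters of $M^2$ (i.e. semi-canonical with $E=1$, $F=0$, $G=|\mu^2-\nu^2|^{-1/2}$).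
   Context: $\mathbb R^4$ carries the standard metric $g=\langle\cdot,\cdot\rangle$ and flat connection $\nabla'$; everything is smooth and local. For a regular surface $M^2: z=z(u,v)$ let $E,F,G$ be the first fundamental form coefficients, $\sigma$ the second fundamental form, $K$ the Gauss curvature, and $\varkappa$ the curvature of the normal connection, $\varkappa=g(R^\perp(x,y)n_2,n_1)$ for a positively oriented orthonormal frame $(x,y,n_1,n_2)$ with $x,y$ tangent. Minimal means $\sigma(x,x)+\sigma(y,y)=0$ for orthonormal tangent $x,y$. A minimal surface is of general type if $K^2-\varkappa^2>0$ and $\varkappa\neq0$ everywhere. The ellipse of curvature at $p$ is $\{\sigma(v,v): v\in T_pM^2,\ |v|=1\}$; a tangent line is canonical if it is collinear with an axis of this ellipse. The geometric frame is a positively oriented orthonormal frame $\{x,y,n_1,n_2\}$ with $x,y$ canonical tangent fields and $n_1,n_2$ normal, satisfying $\nabla'_xx=\gamma_1y+\nu n_1$, $\nabla'_xy=-\gamma_1x+\mu n_2$, $\nabla'_yx=-\gamma_2y+\mu n_2$, $\nabla'_yy=\gamma_2x-\nu n_1$, $\nabla'_xn_1=-\nu x+\beta_1n_2$, $\nabla'_yn_1=\nu y+\beta_2n_2$, $\nabla'_xn_2=-\mu y-\beta_1n_1$, $\nabla'_yn_2=-\mu x-\beta_2n_1$, with $\mu>0$, $\nu\ne0$, $\mu^2\ne\nu^2$; the functions $\nu,\mu,\gamma_1,\gamma_2,\beta_1,\beta_2$ are the invariants of $M^2$. Parameters $(u,v)$ are semi-canonical if the parametric lines are integral curves of the canonical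 tangents, with $F=0$, $x=z_u/\sqrt E$, $y=z_v/\sqrt G$; then $\gamma_1=-y(\ln\sqrt E)$, $\gamma_2=-x(\ln\sqrt G)$. *)

(* Defs.v *)
From Stdlib Require Import Reals.
Open Scope R_scope.

Record V4 := mkV4 { c0 : R; c1 : R; c2 : R; c3 : R }.

Definition vadd (a b : V4) : V4 :=
  mkV4 (c0 a + c0 b) (c1 a + c1 b) (c2 a + c2 b) (c3 a + c3 b).
Definition vscal (k : R) (a : V4) : V4 :=
  mkV4 (k * c0 a) (k * c1 a) (k * c2 a) (k * c3 a).
Definition vzero : V4 := mkV4 0 0 0 0.
Definition vsub (a b : V4) : V4 := vadd a (vscal (-1) b).
Definition dot (a b : V4) : R :=
  c0 a * c0 b + c1 a * c1 b + c2 a * c2 b + c3 a * c3 b.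

Definition det3 (a11 a12 a13 a21 a22 a23 a31 a32 a33 : R) : R :=
  a11 * (a22 * a33 - a23 * a32) - a12 * (a21 * a33 - a23 * a31)
  + a13 * (a21 * a32 - a22 * a31).

Definition det4 (a b c d : V4) : R :=
    c0 a * det3 (c1 b) (c1 c) (c1 d) (c2 b) (c2 c) (c2 d) (c3 b) (c3 c) (c3 d)
  - c1 a * det3 (c0 b) (c0 c) (c0 d) (c2 b) (c2 c) (c2 d) (c3 b) (c3 c) (c3 d)
  + c2 a * det3 (c0 b) (c0 c) (c0 d) (c1 b) (c1 c) (c1 d) (c3 b) (c3 c) (c3 d)
  - c3 a * det3 (c0 b) (c0 c) (c0 d) (c1 b) (c1 c) (c1 d) (c2 b) (c2 c) (c2 d).

Definition is_interval (J : R -> Prop) : Prop :=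
  (exists x, J x) /\
  (forall x y w, J x -> J w -> x <= y <= w -> J y) /\
  (forall x, J x -> exists e, 0 < e /\ forall y, Rabs (y - x) < e -> J y).

Definition smooth1 (J : R -> Prop) (f : R -> R) : Prop :=
  exists d : nat -> R -> R,
    (forall u, J u -> d O u = f u) /\
    (forall n u, J u -> derivable_pt_lim (d n) u (d (S n) u)).

Definition dom2 := R -> R -> Prop.

Definition pdu (D : dom2) (f g : R -> R -> R) : Prop :=
  forall u v, D u v -> derivable_pt_lim (fun s => f s v) u (g u v).
Definition pdv (D : dom2) (f g : R -> R -> R) : Prop :=
  forall u v, D u v -> derivable_pt_lim (fun t => f u t) v (g u v).

Definition cont2 (D : dom2) (f : R -> R -> R) : Prop :=
  forall u v, D u v -> forall eps, 0 < eps -> exists del, 0 < del /\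
    forall u' v', D u' v' -> Rabs (u' - u) < del -> Rabs (v' - v) < del ->
      Rabs (f u' v' - f u v) < eps.

Definition smooth2 (D : dom2) (f : R -> R -> R) : Prop :=
  exists d : nat -> nat -> R -> R -> R,
    (forall u v, D u v -> d O O u v = f u v) /\
    (forall i j, pdu D (d i j) (d (S i) j) /\ pdv D (d i j) (d i (S j))
                 /\ cont2 D (d i j)).

Definition comp0 (X : R -> R -> V4) := fun u v => c0 (X u v).
Definition comp1 (X : R -> R -> V4) := fun u v => c1 (X u v).
Definition comp2 (X : R -> R -> V4) := fun u v => c2 (X u v).
Definition comp3 (X : R -> R -> V4) := fun u v => c3 (X u v).

Definition Vsmooth2 (D : dom2) (X : R -> R -> V4) : Prop :=
  smooth2 D (comp0 X) /\ smooth2 D (comp1 X) /\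
  smooth2 D (comp2 X) /\ smooth2 D (comp3 X).

Definition Vpdu (D : dom2) (X Y : R -> R -> V4) : Prop :=
  pdu D (comp0 X) (comp0 Y) /\ pdu D (comp1 X) (comp1 Y) /\
  pdu D (comp2 X) (comp2 Y) /\ pdu D (comp3 X) (comp3 Y).
Definition Vpdv (D : dom2) (X Y : R -> R -> V4) : Prop :=
  pdv D (comp0 X) (comp0 Y) /\ pdv D (comp1 X) (comp1 Y) /\
  pdv D (comp2 X) (comp2 Y) /\ pdv D (comp3 X) (comp3 Y).

Definition nproj (n1 n2 V : V4) : V4 :=
  vadd (vscal (dot V n1) n1) (vscal (dot V n2) n2).

Definition canonical_surface (J J' : R -> Prop) (nu mu : R -> R)
    (z : R -> R -> V4) : Prop :=
  let D : dom2 := fun u v => J u /\ J' v in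
  exists zu zv x y n1 n2 xu xv yu yv n1u n1v n2u n2v : R -> R -> V4,
  exists ga1 ga2 be1 be2 : R -> R -> R,
  let E := fun u v => dot (zu u v) (zu u v) in
  let F := fun u v => dot (zu u v) (zv u v) in
  let G := fun u v => dot (zv u v) (zv u v) in
  (* nabla'_x and nabla'_y of a field with partials Xu, Xv *)
  let Dx := fun (Xu : R -> R -> V4) u v => vscal (/ sqrt (E u v)) (Xu u v) in
  let Dy := fun (Xv : R -> R -> V4) u v => vscal (/ sqrt (G u v)) (Xv u v) in
  let sxx := fun u v => nproj (n1 u v) (n2 u v) (Dx xu u v) in
  let sxy := fun u v => nproj (n1 u v) (n2 u v) (Dx yu u v) in
  let syy := fun u v => nproj (n1 u v) (n2 u v) (Dy yv u v) in
  Vsmooth2 D z /\ Vpdu D z zu /\ Vpdv D z zv /\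
  Vsmooth2 D n1 /\ Vsmooth2 D n2 /\
  Vpdu D x xu /\ Vpdv D x xv /\ Vpdu D y yu /\ Vpdv D y yv /\
  Vpdu D n1 n1u /\ Vpdv D n1 n1v /\ Vpdu D n2 n2u /\ Vpdv D n2 n2v /\
  (forall u v, D u v ->
    E u v * G u v - F u v ^ 2 > 0 /\
    F u v = 0 /\
    x u v = vscal (/ sqrt (E u v)) (zu u v) /\
    y u v = vscal (/ sqrt (G u v)) (zv u v) /\
    E u v = 1 /\
    G u v = / sqrt (Rabs (mu u ^ 2 - nu u ^ 2)) /\
    dot (x u v) (x u v) = 1 /\ dot (y u v) (y u v) = 1 /\
    dot (n1 u v) (n1 u v) = 1 /\ dot (n2 u v) (n2 u v) = 1 /\
    dot (x u v) (y u v) = 0 /\ dot (x u v) (n1 u v) = 0 /\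
    dot (x u v) (n2 u v) = 0 /\ dot (y u v) (n1 u v) = 0 /\
    dot (y u v) (n2 u v) = 0 /\ dot (n1 u v) (n2 u v) = 0 /\
    det4 (x u v) (y u v) (n1 u v) (n2 u v) > 0 /\
    mu u > 0 /\ nu u <> 0 /\ mu u ^ 2 <> nu u ^ 2 /\ ga1 u v = 0 /\
    Dx xu u v = vadd (vscal (ga1 u v) (y u v)) (vscal (nu u) (n1 u v)) /\
    Dx yu u v = vadd (vscal (- ga1 u v) (x u v)) (vscal (mu u) (n2 u v)) /\
    Dy xv u v = vadd (vscal (- ga2 u v) (y u v)) (vscal (mu u) (n2 u v)) /\
    Dy yv u v = vadd (vscal (ga2 u v) (x u v)) (vscal (- nu u) (n1 u v)) /\
    Dx n1u u v = vadd (vscal (- nu u) (x u v)) (vscal (be1 u v) (n2 u v)) /\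
    Dy n1v u v = vadd (vscal (nu u) (y u v)) (vscal (be2 u v) (n2 u v)) /\
    Dx n2u u v = vadd (vscal (- mu u) (y u v)) (vscal (- be1 u v) (n1 u v)) /\
    Dy n2v u v = vadd (vscal (- mu u) (x u v)) (vscal (- be2 u v) (n1 u v)) /\
    vadd (sxx u v) (syy u v) = vzero /\
    (* x and y are canonical tangents: sigma(x,x), sigma(y,y) are vertices
       (points at extremal distance from the centre) of the ellipse of
       curvature { sigma(w,w) : w = cos t x + sin t y } *)
    (let cen := vscal (/ 2) (vadd (sxx u v) (syy u v)) in
     let sww := fun t => vadd (vadd (vscal (cos t ^ 2) (sxx u v))
                         (vscal (2 * cos t * sin t) (sxy u v)))
                         (vscal (sin t ^ 2) (syy u v)) in
     let d2 := fun P : V4 => dot (vsub P cen) (vsub P cen) in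
     ((forall t, d2 (sww t) <= d2 (sxx u v)) \/
      (forall t, d2 (sxx u v) <= d2 (sww t))) /\
     ((forall t, d2 (sww t) <= d2 (syy u v)) \/
      (forall t, d2 (syy u v) <= d2 (sww t))))) /\
  (* general type: K^2 - kappa^2 > 0 and kappa <> 0, where
     K = g(R(x,y)y,x) and kappa = g(R^perp(x,y)n2,n1) are computed from the
     tangent / normal connection forms in the coordinate fields:
       K     = ((<x_u,y>)_v - (<x_v,y>)_u) / sqrt(EG),
       kappa = ((<n1_u,n2>)_v - (<n1_v,n2>)_u) / sqrt(EG). *)
  (exists thuv thvu omuv omvu : R -> R -> R,
    pdv D (fun u v => dot (xu u v) (y u v)) thuv /\
    pdu D (fun u v => dot (xv u v) (y u v)) thvu /\
    pdv D (fun u v => dot (n1u u v) (n2 u v)) omuv /\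
    pdu D (fun u v => dot (n1v u v) (n2 u v)) omvu /\
    forall u v, D u v ->
      let K := (thuv u v - thvu u v) / sqrt (E u v * G u v) in
      let kap := (omuv u v - omvu u v) / sqrt (E u v * G u v) in
      K ^ 2 - kap ^ 2 > 0 /\ kap <> 0).

Definition rigid_apply (a0 a1 a2 a3 b p : V4) : V4 :=
  vadd (vadd (vadd (vadd (vscal (c0 p) a0) (vscal (c1 p) a1))
                   (vscal (c2 p) a2)) (vscal (c3 p) a3)) b.

Definition congruent (D : dom2) (z1 z2 : R -> R -> V4) : Prop :=
  exists a0 a1 a2 a3 b : V4,
    dot a0 a0 = 1 /\ dot a1 a1 = 1 /\ dot a2 a2 = 1 /\ dot a3 a3 = 1 /\
    dot a0 a1 = 0 /\ dot a0 a2 = 0 /\ dot a0 a3 = 0 /\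
    dot a1 a2 = 0 /\ dot a1 a3 = 0 /\ dot a2 a3 = 0 /\
    det4 a0 a1 a2 a3 = 1 /\
    forall u v, D u v -> z2 u v = rigid_apply a0 a1 a2 a3 b (z1 u v).

(* Main.v *)
(** Put [w = |mu^2 - nu^2|], [g = w^(-1/4) = sqrt G], [ga = (ln w)' / 4 = gamma_2] and
    [be = (ln |(mu+nu)/(mu-nu)|)' / 2 = beta_2]. The two differential equations, together
    with the definitions of [ga] and [be], form a first-order system for
    [nu, mu, ga, be, g], which is the integrability condition (with [beta_1 = 0]) of the
    derivative formulas of the frame.

    Existence is explicit. The vectors [g (be + ga, mu + nu)] and [g (be - ga, mu - nu)]
    rotate with angular velocities [nu + mu] and [nu - mu]. Their polar angles are
    therefore sums and differences of angles [th], [ph] with [th' = nu], [ph' = mu], and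
    their lengths give constants [a], [b]. The surface is swept out by the one-parameter
    group that rotates two orthogonal planes with speeds [a] and [b]:
    [x] and [n1] arise by rotating [(cos av, sin av, 0, 0)] and [(0, 0, cos bv, sin bv)]
    through [th], while [y] and [n2] arise by rotating [(-sin av, cos av, 0, 0)] and
    [(0, 0, -sin bv, cos bv)] through [ph].

    For uniqueness, comparing mixed partial derivatives up to order three shows that the
    frame of any canonical surface has [gamma_2 = ga], [beta_1 = 0], [beta_2 = be]. Two
    such frames solve the same linear system with skew-symmetric coefficients, so one is
    a constant rotation of the other. *)
From Stdlib Require Import Reals Lra.
From Coquelicot Require Import Coquelicot.
Require Import Defs.
Open Scope R_scope.

(** * Differentiation rules in one variable *)

Lemma dlim_eq (f : R -> R) (x l l' : R) :
  derivable_pt_lim f x l -> l = l' -> derivable_pt_lim f x l'.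
Proof. now intros H <-. Qed.

Lemma dlim_cst (c x : R) : derivable_pt_lim (fun _ => c) x 0.
Proof. apply derivable_pt_lim_const. Qed.

Lemma dlim_id (x : R) : derivable_pt_lim (fun s => s) x 1.
Proof. apply derivable_pt_lim_id. Qed.

Lemma dlim_opp (f : R -> R) (x a : R) :
  derivable_pt_lim f x a -> derivable_pt_lim (fun s => - f s) x (- a).
Proof. apply derivable_pt_lim_opp. Qed.

Lemma dlim_plus (f h : R -> R) (x a b : R) :
  derivable_pt_lim f x a -> derivable_pt_lim h x b ->
  derivable_pt_lim (fun s => f s + h s) x (a + b).
Proof. apply derivable_pt_lim_plus. Qed.

Lemma dlim_minus (f h : R -> R) (x a b : R) :
  derivable_pt_lim f x a -> derivable_pt_lim h x b ->
  derivable_pt_lim (fun s => f s - h s) x (a - b).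
Proof. apply derivable_pt_lim_minus. Qed.

Lemma dlim_mult (f h : R -> R) (x a b : R) :
  derivable_pt_lim f x a -> derivable_pt_lim h x b ->
  derivable_pt_lim (fun s => f s * h s) x (a * h x + f x * b).
Proof. apply derivable_pt_lim_mult. Qed.

Lemma dlim_comp (f h : R -> R) (x a b : R) :
  derivable_pt_lim f x a -> derivable_pt_lim h (f x) b ->
  derivable_pt_lim (fun s => h (f s)) x (b * a).
Proof. apply derivable_pt_lim_comp. Qed.

Lemma dlim_cos (f : R -> R) (x a : R) :
  derivable_pt_lim f x a ->
  derivable_pt_lim (fun s => cos (f s)) x (- sin (f x) * a).
Proof.
intros H; exact (dlim_comp f cos x a _ H (derivable_pt_lim_cos _)).
Qed.

Lemma dlim_sin (f : R -> R) (x a : R) :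
  derivable_pt_lim f x a ->
  derivable_pt_lim (fun s => sin (f s)) x (cos (f x) * a).
Proof.
intros H; exact (dlim_comp f sin x a _ H (derivable_pt_lim_sin _)).
Qed.

(** The derivative comes out in whatever form the rules produce; after [dlim_eq], matching it with
    the wanted value is a goal for [ring] or [field]. *)
Ltac dlim :=
  repeat first
    [ assumption
    | match goal with
      | H : forall _, _ |- derivable_pt_lim _ _ _ => eapply H; solve [eassumption]
      end
    | apply dlim_cst | apply dlim_id
    | eapply dlim_opp | eapply dlim_plus | eapply dlim_minus
    | eapply dlim_mult | eapply dlim_cos | eapply dlim_sin ].

(** * Uniqueness of derivatives, and functions whose derivatives vanish *)

(** The last clause of [is_interval] makes [J] open, so agreement on [J] is agreement near [u]. *)
Lemma dlim_ext (J : R -> Prop) (f h : R -> R) (u l : R) :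
  is_interval J -> J u -> (forall s, J s -> f s = h s) ->
  derivable_pt_lim f u l -> derivable_pt_lim h u l.
Proof.
intros (_ & _ & HJ) Ju Hfh Hf.
apply is_derive_Reals. apply is_derive_Reals in Hf.
apply (is_derive_ext_loc f); [|exact Hf].
destruct (HJ u Ju) as [e [He HeJ]].
exists (mkposreal e He); intros s Hs; apply Hfh, HeJ, Hs.
Qed.

Lemma dlim_unique (J : R -> Prop) (f h : R -> R) (u l m : R) :
  is_interval J -> J u -> (forall s, J s -> f s = h s) ->
  derivable_pt_lim f u l -> derivable_pt_lim h u m -> l = m.
Proof.
intros HJ Ju Hfh Hf Hh.
apply (uniqueness_limite h u); [|exact Hh].
now apply (dlim_ext J f).
Qed.

Lemma zero_derivative_constant (J : R -> Prop) (f : R -> R) :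
  is_interval J -> (forall u, J u -> derivable_pt_lim f u 0) ->
  forall u w, J u -> J w -> f u = f w.
Proof.
intros (_ & Hc & _) Hf.
assert (Hlt : forall u w, J u -> J w -> u < w -> f u = f w).
{ intros u w Ju Jw Huw.
  destruct (MVT_cor2 f (fun _ => 0) u w Huw) as [c [Hfc _]].
  - intros c Hcw; apply Hf; now apply (Hc u c w).
  - simpl in Hfc; lra. }
intros u w Ju Jw; destruct (Rtotal_order u w) as [H | [-> | H]];
  [ now apply Hlt | reflexivity | now symmetry; apply Hlt ].
Qed.

(** Moves along [u] first and then along [v]; both segments stay inside the rectangle. *)
Lemma zero_partials_constant (J J' : R -> Prop) (f : R -> R -> R) :
  is_interval J -> is_interval J' ->
  pdu (fun u v => J u /\ J' v) f (fun _ _ => 0) ->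
  pdv (fun u v => J u /\ J' v) f (fun _ _ => 0) ->
  forall u v u' v', J u -> J' v -> J u' -> J' v' -> f u v = f u' v'.
Proof.
intros HJ HJ' Hu Hv u v u' v' Ju Jv Ju' Jv'.
transitivity (f u' v).
- apply (zero_derivative_constant J (fun s => f s v) HJ); try assumption.
  intros s Js; now apply Hu.
- apply (zero_derivative_constant J' (fun t => f u' t) HJ'); try assumption.
  intros s Js; now apply Hv.
Qed.

Lemma pdu_unique (J J' : R -> Prop) (f h f' h' : R -> R -> R) :
  is_interval J -> (forall u v, J u -> J' v -> f u v = h u v) ->
  pdu (fun u v => J u /\ J' v) f f' -> pdu (fun u v => J u /\ J' v) h h' ->
  forall u v, J u -> J' v -> f' u v = h' u v.
Proof.
intros HJ Hfh Hf Hh u v Ju Jv.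
apply (dlim_unique J (fun s => f s v) (fun s => h s v) u);
  [exact HJ | exact Ju | auto | now apply Hf | now apply Hh].
Qed.

Lemma pdv_unique (J J' : R -> Prop) (f h f' h' : R -> R -> R) :
  is_interval J' -> (forall u v, J u -> J' v -> f u v = h u v) ->
  pdv (fun u v => J u /\ J' v) f f' -> pdv (fun u v => J u /\ J' v) h h' ->
  forall u v, J u -> J' v -> f' u v = h' u v.
Proof.
intros HJ Hfh Hf Hh u v Ju Jv.
apply (dlim_unique J' (fun s => f u s) (fun s => h u s) v);
  [exact HJ | exact Jv | auto | now apply Hf | now apply Hh].
Qed.

(** * Antiderivatives, logarithms and rotating plane vectors *)

(** Differentiability of [f] gives the continuity that makes its integral from a base point an
    antiderivative. *)
Lemma antiderivative_exists (J : R -> Prop) (f f' : R -> R) :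
  is_interval J -> (forall u, J u -> derivable_pt_lim f u (f' u)) ->
  exists F, forall u, J u -> derivable_pt_lim F u (f u).
Proof.
intros ((u0 & Ju0) & Hc & Ho) Hf.
assert (Hcont : forall u, J u -> continuous f u).
{ intros u Ju; apply continuity_pt_filterlim, derivable_continuous_pt.
  exists (f' u); now apply Hf. }
exists (fun u => RInt f u0 u); intros u Ju; apply is_derive_Reals.
apply is_derive_RInt with (a := u0); [|now apply Hcont].
destruct (Ho u Ju) as [e [He HeJ]].
exists (mkposreal e He); intros s Hs.
apply (RInt_correct (V := R_CompleteNormedModule)).
apply (ex_RInt_continuous (V := R_CompleteNormedModule)).
intros w [Hw1 Hw2]; apply Hcont.
assert (Js : J s) by apply HeJ, Hs.
unfold Rmin, Rmax in *.
destruct (Rle_dec u0 s); [apply (Hc u0 w s) | apply (Hc s w u0)]; auto; lra.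
Qed.

(** Writing [ln |f|] as half of [ln (f * f)] avoids a case distinction on the sign of [f]. *)
Lemma dlim_ln_abs (f : R -> R) (u l : R) :
  f u <> 0 -> derivable_pt_lim f u l ->
  derivable_pt_lim (fun s => ln (Rabs (f s))) u (l / f u).
Proof.
intros Hfu Hf.
(* Since Stdlib sets [ln 0 = 0], this holds for [x = 0] as well. *)
assert (Hln : forall x, / 2 * ln (x * x) = ln (Rabs x)).
{ intros x; destruct (Req_dec x 0) as [-> | Hx].
  - rewrite Rabs_R0, Rmult_0_l; unfold ln.
    destruct (Rlt_dec 0 0) as [H | _]; [destruct (Rlt_irrefl 0 H) | lra].
  - replace (x * x) with (Rabs x * Rabs x)
      by (rewrite <- Rabs_mult; apply Rabs_pos_eq; nra).
    rewrite ln_mult by now apply Rabs_pos_lt.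
    lra. }
apply is_derive_Reals.
apply (is_derive_ext (fun s => / 2 * ln (f s * f s))); [intros; apply Hln|].
apply is_derive_Reals.
eapply dlim_eq.
- apply dlim_mult; [apply dlim_cst|].
  apply (dlim_comp (fun s => f s * f s) ln).
  + apply dlim_mult; eassumption.
  + apply derivable_pt_lim_ln; nra.
- cbv beta; now field.
Qed.

(** The radius [r] may be negative, so that [atan] covers both half-planes [X > 0] and [X < 0]. *)
Lemma polar_coordinates (X Y : R) : exists r t, X = r * cos t /\ Y = r * sin t.
Proof.
destruct (Req_dec X 0) as [-> | HX].
- exists Y, (PI / 2); rewrite cos_PI2, sin_PI2; lra.
- assert (Hc : 0 < cos (atan (Y / X)))
    by (destruct (atan_bound (Y / X)); apply cos_gt_0; lra).
  exists (X / cos (atan (Y / X))), (atan (Y / X)).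
  split; [field; lra|].
  transitivity (X * tan (atan (Y / X))).
  + rewrite tan_atan; now field.
  + unfold tan; field; lra.
Qed.

(** Turning the vector back through an antiderivative [s] of its angular velocity makes it constant;
    the polar angle of that constant vector is the phase to add to [s]. *)
Lemma rotating_vector_polar (J : R -> Prop) (om om' X Y : R -> R) :
  is_interval J ->
  (forall u, J u -> derivable_pt_lim om u (om' u)) ->
  (forall u, J u -> derivable_pt_lim X u (- om u * Y u)) ->
  (forall u, J u -> derivable_pt_lim Y u (om u * X u)) ->
  exists r t, (forall u, J u -> derivable_pt_lim t u (om u)) /\
    forall u, J u -> X u = r * cos (t u) /\ Y u = r * sin (t u).
Proof.
intros HJ Hom HX HY.
destruct (antiderivative_exists J om om' HJ Hom) as [s Hs].
(* [(C, S)] is the vector [(X, Y)] turned back through the angle [s]. *)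
pose (C := fun u => X u * cos (s u) + Y u * sin (s u)).
pose (S := fun u => Y u * cos (s u) - X u * sin (s u)).
destruct (proj1 HJ) as [u0 Ju0].
assert (HC : forall u, J u -> C u = C u0).
{ intros u Ju; apply (zero_derivative_constant J); auto.
  intros w Jw; unfold C; eapply dlim_eq; [dlim | cbv beta; ring]. }
assert (HS : forall u, J u -> S u = S u0).
{ intros u Ju; apply (zero_derivative_constant J); auto.
  intros w Jw; unfold S; eapply dlim_eq; [dlim | cbv beta; ring]. }
destruct (polar_coordinates (C u0) (S u0)) as (r & t0 & Hr1 & Hr2).
exists r, (fun u => s u + t0); split.
- intros u Ju; eapply dlim_eq; [dlim | cbv beta; ring].
- intros u Ju; rewrite cos_plus, sin_plus.
  generalize (HC u Ju) (HS u Ju) (sin2_cos2 (s u)).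
  rewrite Hr1, Hr2; unfold C, S, Rsqr; intros E1 E2 E3.
  split.
  + transitivity (cos (s u) * (r * cos t0) - sin (s u) * (r * sin t0)); [|ring].
    rewrite <- E1, <- E2.
    transitivity (X u * (sin (s u) * sin (s u) + cos (s u) * cos (s u)));
      [rewrite E3|]; ring.
  + transitivity (sin (s u) * (r * cos t0) + cos (s u) * (r * sin t0)); [|ring].
    rewrite <- E1, <- E2.
    transitivity (Y u * (sin (s u) * sin (s u) + cos (s u) * cos (s u)));
      [rewrite E3|]; ring.
Qed.

(** * Smoothness in one variable *)

(** [smooth1] asks for the whole sequence of derivatives as one witness; a syntax with a formal
    derivative provides it by iteration. *)
Inductive diff_expr (I : Type) : Type :=
| Cst : R -> diff_expr I
| Gen : I -> diff_expr I
| Add : diff_expr I -> diff_expr I -> diff_expr I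
| Mul : diff_expr I -> diff_expr I -> diff_expr I.
Arguments Cst {I}. Arguments Gen {I}. Arguments Add {I}. Arguments Mul {I}.

Fixpoint deval {I : Type} (env : I -> R -> R) (e : diff_expr I) (u : R) : R :=
  match e with
  | Cst r => r
  | Gen i => env i u
  | Add a b => deval env a u + deval env b u
  | Mul a b => deval env a u * deval env b u
  end.

Fixpoint dderiv {I : Type} (dg : I -> diff_expr I) (e : diff_expr I) : diff_expr I :=
  match e with
  | Cst _ => Cst 0
  | Gen i => dg i
  | Add a b => Add (dderiv dg a) (dderiv dg b)
  | Mul a b => Add (Mul (dderiv dg a) b) (Mul a (dderiv dg b))
  end.

(* The polynomials in functions whose derivatives are again polynomials in them
   form a ring closed under differentiation. *)
Lemma smooth1_deval (I : Type) (J : R -> Prop) (env : I -> R -> R)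
    (dg : I -> diff_expr I) (e : diff_expr I) :
  (forall i u, J u -> derivable_pt_lim (env i) u (deval env (dg i) u)) ->
  smooth1 J (deval env e).
Proof.
intros Hdg.
exists (fun n => deval env (Nat.iter n (dderiv dg) e)); split; [reflexivity|].
intros n u Ju; simpl; generalize (Nat.iter n (dderiv dg) e) as f.
induction f as [r | i | a IHa b IHb | a IHa b IHb]; simpl.
- apply dlim_cst.
- now apply Hdg.
- now apply dlim_plus.
- now apply dlim_mult.
Qed.

(** [Rate n] stands for the [n]-th derivative of the angular velocity; together with the cosine and
    sine of the angle these generators are closed under differentiation. *)
Inductive trig_gen := Rate (n : nat) | Cosine | Sine.

Lemma smooth1_cos_sin (J : R -> Prop) (om t : R -> R) :
  smooth1 J om -> (forall u, J u -> derivable_pt_lim t u (om u)) ->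
  smooth1 J (fun u => cos (t u)) /\ smooth1 J (fun u => sin (t u)).
Proof.
intros [d [Hd0 Hd]] Ht.
pose (env := fun i => match i with
  | Rate n => d n | Cosine => fun u => cos (t u) | Sine => fun u => sin (t u) end).
pose (dg := fun i => match i with
  | Rate n => Gen (Rate (S n))
  | Cosine => Mul (Cst (-1)) (Mul (Gen (Rate 0)) (Gen Sine))
  | Sine => Mul (Gen (Rate 0)) (Gen Cosine) end).
assert (Hdg : forall i u, J u -> derivable_pt_lim (env i) u (deval env (dg i) u)).
{ intros [n | | ] u Ju; simpl.
  - now apply Hd.
  - eapply dlim_eq; [dlim | rewrite Hd0 by exact Ju; ring].
  - eapply dlim_eq; [dlim | rewrite Hd0 by exact Ju; ring]. }
split.
- exact (smooth1_deval trig_gen J env dg (Gen Cosine) Hdg).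
- exact (smooth1_deval trig_gen J env dg (Gen Sine) Hdg).
Qed.

Lemma smooth1_antiderivative (J : R -> Prop) (f F : R -> R) :
  smooth1 J f -> (forall u, J u -> derivable_pt_lim F u (f u)) -> smooth1 J F.
Proof.
intros [d [Hd0 Hd]] HF.
exists (fun n => match n with O => F | S m => d m end); split; [reflexivity|].
intros [|n] u Ju; [rewrite Hd0|]; auto.
Qed.

Lemma smooth1_opp (J : R -> Prop) (f : R -> R) :
  smooth1 J f -> smooth1 J (fun u => - f u).
Proof.
intros [d [Hd0 Hd]]; exists (fun n u => - d n u); split.
- intros u Ju; now rewrite Hd0.
- intros n u Ju; now apply dlim_opp, Hd.
Qed.

Lemma smooth1_const (J : R -> Prop) (c : R) : smooth1 J (fun _ => c).
Proof.
exact (smooth1_deval Empty_set J (fun _ _ => 0) (fun _ => Cst 0) (Cst c)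
         (fun i => match i with end)).
Qed.

Lemma smooth1_linear (J : R -> Prop) (k : R) : smooth1 J (fun v => k * v).
Proof.
apply (smooth1_antiderivative J (fun _ => k)); [apply smooth1_const|].
intros u _; eapply dlim_eq; [dlim | cbv beta; ring].
Qed.

(** * Smoothness in two variables for sums of separated products *)

Lemma cont2_mult_sep (J J' : R -> Prop) (f h f' h' : R -> R) :
  (forall u, J u -> derivable_pt_lim f u (f' u)) ->
  (forall v, J' v -> derivable_pt_lim h v (h' v)) ->
  cont2 (fun u v => J u /\ J' v) (fun u v => f u * h v).
Proof.
intros Hf Hh u v [Ju Jv] eps Heps.
assert (Hc : continuity_2d_pt (fun u v => f u * h v) u v).
{ apply continuity_2d_pt_mult.
  - apply (continuity_1d_2d_pt_comp f (fun u _ => u)).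
    + apply derivable_continuous_pt; exists (f' u); now apply Hf.
    + apply continuity_2d_pt_id1.
  - apply (continuity_1d_2d_pt_comp h (fun _ v => v)).
    + apply derivable_continuous_pt; exists (h' v); now apply Hh.
    + apply continuity_2d_pt_id2. }
destruct (Hc (mkposreal eps Heps)) as [del Hdel].
exists del; split; [apply cond_pos|].
intros u' v' _ Hu Hv; exact (Hdel u' v' Hu Hv).
Qed.

(** The coordinates of the explicit surface and of its normal fields are sums of such products, and
    their partial derivatives factor in the same way. *)
Lemma smooth2_mult_sep (J J' : R -> Prop) (f h : R -> R) :
  smooth1 J f -> smooth1 J' h ->
  smooth2 (fun u v => J u /\ J' v) (fun u v => f u * h v).
Proof.
intros [d [Hd0 Hd]] [e [He0 He]].
exists (fun i j u v => d i u * e j v); split; [|intros i j; split; [|split]].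
- intros u v [Ju Jv]; now rewrite Hd0, He0.
- intros u v [Ju Jv]; eapply dlim_eq; [dlim | cbv beta; ring].
- intros u v [Ju Jv]; eapply dlim_eq; [dlim | cbv beta; ring].
- apply (cont2_mult_sep J J' _ _ (d (S i)) (e (S j))); auto.
Qed.

Lemma smooth2_plus (D : dom2) (f h : R -> R -> R) :
  smooth2 D f -> smooth2 D h -> smooth2 D (fun u v => f u v + h u v).
Proof.
intros [d [Hd0 Hd]] [e [He0 He]].
exists (fun i j u v => d i j u v + e i j u v);
  split; [|intros i j; split; [|split]].
- intros u v HD; now rewrite Hd0, He0.
- intros u v HD; apply dlim_plus; [now apply Hd | now apply He].
- intros u v HD; apply dlim_plus; [now apply Hd | now apply He].
- intros u v HD eps Heps.
  destruct (proj2 (proj2 (Hd i j)) u v HD (eps / 2)) as [r [Hr Hr']]; [lra|].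
  destruct (proj2 (proj2 (He i j)) u v HD (eps / 2)) as [s [Hs Hs']]; [lra|].
  exists (Rmin r s); split; [now apply Rmin_glb_lt|].
  intros u' v' HD' Hu Hv.
  assert (H1 := Hr' u' v' HD' (Rlt_le_trans _ _ _ Hu (Rmin_l r s))
                  (Rlt_le_trans _ _ _ Hv (Rmin_l r s))).
  assert (H2 := Hs' u' v' HD' (Rlt_le_trans _ _ _ Hu (Rmin_r r s))
                  (Rlt_le_trans _ _ _ Hv (Rmin_r r s))).
  replace (d i j u' v' + e i j u' v' - (d i j u v + e i j u v))
    with ((d i j u' v' - d i j u v) + (e i j u' v' - e i j u v)) by ring.
  eapply Rle_lt_trans; [apply Rabs_triang | lra].
Qed.

(** * The first-order system for the invariants and its integration by rotation angles *)

(** The equations for [nu] and [mu] are the definitions of [ga] and [be] solved for the two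
    derivatives; those for [ga] and [be] are the two second-order equations of the theorem. *)
Definition invariants_system (J : R -> Prop) (nu mu ga be g : R -> R) : Prop :=
  (forall u, J u -> mu u > 0 /\ nu u <> 0 /\ mu u ^ 2 <> nu u ^ 2) /\
  (forall u, J u -> 0 < g u) /\
  (forall u, J u -> g u * g u = / sqrt (Rabs (mu u ^ 2 - nu u ^ 2))) /\
  (forall u, J u -> derivable_pt_lim nu u (2 * ga u * nu u + mu u * be u)) /\
  (forall u, J u -> derivable_pt_lim mu u (2 * ga u * mu u + nu u * be u)) /\
  (forall u, J u -> derivable_pt_lim ga u (ga u ^ 2 - nu u ^ 2 - mu u ^ 2)) /\
  (forall u, J u -> derivable_pt_lim be u (ga u * be u - 2 * nu u * mu u)) /\
  (forall u, J u -> derivable_pt_lim g u (- (ga u * g u))).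

Lemma smooth1_derivative (J : R -> Prop) (f : R -> R) :
  is_interval J -> smooth1 J f ->
  exists f', forall u, J u -> derivable_pt_lim f u (f' u).
Proof.
intros HJ [d [Hd0 Hd]]; exists (d 1%nat); intros u Ju.
apply (dlim_ext J (d 0%nat)); auto.
Qed.

Lemma invariants_system_exists (J : R -> Prop) (nu mu L1 L2 P1 P2 : R -> R) :
  is_interval J -> smooth1 J nu -> smooth1 J mu ->
  (forall u, J u -> mu u > 0 /\ nu u <> 0 /\ mu u ^ 2 <> nu u ^ 2) ->
  (forall u, J u ->
     derivable_pt_lim (fun s => ln (Rabs (mu s ^ 2 - nu s ^ 2))) u (L1 u) /\
     derivable_pt_lim L1 u (L2 u) /\
     derivable_pt_lim (fun s => ln (Rabs ((mu s + nu s) / (mu s - nu s)))) u (P1 u) /\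
     derivable_pt_lim P1 u (P2 u) /\
     / 4 * L2 u - / 16 * L1 u ^ 2 + nu u ^ 2 + mu u ^ 2 = 0 /\
     / 2 * P2 u - / 8 * L1 u * P1 u + 2 * nu u * mu u = 0) ->
  exists ga be g, invariants_system J nu mu ga be g.
Proof.
intros HJ Snu Smu Hnd Hode.
destruct (smooth1_derivative J nu HJ Snu) as [nu' Hnu].
destruct (smooth1_derivative J mu HJ Smu) as [mu' Hmu].
pose (w := fun s => Rabs (mu s ^ 2 - nu s ^ 2)).
assert (Hw : forall u, J u -> 0 < w u).
{ intros u Ju; apply Rabs_pos_lt; destruct (Hnd u Ju) as (_ & _ & H); lra. }
(* Uniqueness of derivatives turns [L1], and then [P1], into explicit linear expressions in [nu']
   and [mu']. *)
assert (HL1 : forall u, J u ->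
  L1 u = 2 * (mu u * mu' u - nu u * nu' u) / (mu u ^ 2 - nu u ^ 2)).
{ intros u Ju; destruct (Hnd u Ju) as (_ & _ & Hne).
  destruct (Hode u Ju) as (HL & _).
  eapply uniqueness_limite; [exact HL|].
  eapply dlim_eq.
  - apply (dlim_ln_abs (fun s => mu s ^ 2 - nu s ^ 2)); [lra|].
    simpl; dlim.
  - cbv beta; field; lra. }
assert (HP1 : forall u, J u ->
  P1 u = 2 * (nu' u * mu u - nu u * mu' u) / (mu u ^ 2 - nu u ^ 2)).
{ intros u Ju; destruct (Hnd u Ju) as (_ & _ & Hne).
  destruct (Hode u Ju) as (_ & _ & HP & _).
  assert (Hp : mu u + nu u <> 0) by (intros E; apply Hne; nra).
  assert (Hm : mu u - nu u <> 0) by (intros E; apply Hne; nra).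
  eapply uniqueness_limite; [exact HP|].
  eapply dlim_eq.
  - apply (dlim_ln_abs (fun s => (mu s + nu s) / (mu s - nu s))).
    + intros E; apply Hp; apply (Rmult_eq_compat_r (mu u - nu u)) in E.
      unfold Rdiv in E; rewrite Rmult_assoc, Rinv_l in E; lra.
    + apply (derivable_pt_lim_div (fun s => mu s + nu s) (fun s => mu s - nu s));
        [dlim | dlim | exact Hm].
  - unfold Rsqr; field; repeat split; auto; nra. }
(* The third witness is [w^(-1/4)]; written with [exp] and [ln], its derivative comes from [L1] by
   the chain rule. *)
exists (fun u => L1 u / 4), (fun u => P1 u / 2), (fun u => exp (- / 4 * ln (w u))).
split; [exact Hnd|].
repeat split; intros u Ju; destruct (Hnd u Ju) as (_ & _ & Hne);
  destruct (Hode u Ju) as (HL & HL' & HP & HP' & EL & EP).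
- apply exp_pos.
- rewrite <- exp_plus, <- Rpower_sqrt, <- Rpower_Ropp by now apply Hw.
  unfold Rpower; f_equal; fold (w u); field.
(* Substituting the explicit [L1] and [P1] into the right-hand side gives back [nu'], and in the
   next goal [mu']; the denominator is [mu^2 - nu^2]. *)
- eapply dlim_eq; [dlim|]; rewrite HL1, HP1 by exact Ju; field; lra.
- eapply dlim_eq; [dlim|]; rewrite HL1, HP1 by exact Ju; field; lra.
- unfold Rdiv; eapply dlim_eq; [dlim|]; cbv beta; nra.
- unfold Rdiv; eapply dlim_eq; [dlim|]; cbv beta; nra.
- eapply dlim_eq.
  + apply (dlim_comp (fun s => - / 4 * ln (w s)) exp);
      [unfold w; dlim | apply derivable_pt_lim_exp].
  + cbv beta; fold (w u); field.
Qed.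

(** For the frame built below, the four left-hand sides are [<x_v, y>], [<x_v, n2>], [<n1_v, y>] and
    [<n1_v, n2>]; the right-hand sides are the values that the derivative formulas prescribe. *)
Lemma rotation_angles (J : R -> Prop) (nu mu ga be g : R -> R) :
  is_interval J -> invariants_system J nu mu ga be g ->
  exists a b th ph,
    (forall u, J u -> derivable_pt_lim th u (nu u)) /\
    (forall u, J u -> derivable_pt_lim ph u (mu u)) /\
    (forall u, J u ->
       a * cos (th u) * cos (ph u) + b * sin (th u) * sin (ph u) = - (g u * ga u) /\
       b * sin (th u) * cos (ph u) - a * cos (th u) * sin (ph u) = g u * mu u /\
       b * cos (th u) * sin (ph u) - a * sin (th u) * cos (ph u) = g u * nu u /\
       a * sin (th u) * sin (ph u) + b * cos (th u) * cos (ph u) = g u * be u).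
Proof.
intros HJ (Hnd & Hg & _ & Hnu & Hmu & Hga & Hbe & Hg').
destruct (rotating_vector_polar J (fun u => nu u + mu u)
  (fun u => 2 * ga u * nu u + mu u * be u + (2 * ga u * mu u + nu u * be u))
  (fun u => - (g u * (ga u + be u))) (fun u => - (g u * (mu u + nu u))) HJ)
  as (r & s & Hs & Hrs).
1-3: intros u Ju; eapply dlim_eq; [dlim | cbv beta; ring].
destruct (rotating_vector_polar J (fun u => nu u - mu u)
  (fun u => 2 * ga u * nu u + mu u * be u - (2 * ga u * mu u + nu u * be u))
  (fun u => g u * (be u - ga u)) (fun u => g u * (mu u - nu u)) HJ)
  as (q & t & Ht & Hqt).
1-3: intros u Ju; eapply dlim_eq; [dlim | cbv beta; ring].
(* The polar angles are [s = th + ph] and [t = th - ph], so the addition formulas express the polar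
   forms by products of sines and cosines of [th] and [ph]; sums and differences of these are the
   four identities. *)
exists ((q + r) / 2), ((q - r) / 2),
  (fun u => / 2 * (s u + t u)), (fun u => / 2 * (s u - t u)).
split; [|split].
- intros u Ju; eapply dlim_eq; [dlim | cbv beta; field].
- intros u Ju; eapply dlim_eq; [dlim | cbv beta; field].
- intros u Ju.
  destruct (Hrs u Ju) as [H1 H2]; destruct (Hqt u Ju) as [H3 H4].
  replace (s u) with (/ 2 * (s u + t u) + / 2 * (s u - t u)) in H1, H2 by field.
  replace (t u) with (/ 2 * (s u + t u) - / 2 * (s u - t u)) in H3, H4 by field.
  rewrite cos_plus in H1; rewrite sin_plus in H2.
  rewrite cos_minus in H3; rewrite sin_minus in H4.
  repeat split; lra.
Qed.

(* If [a = 0] then [F] is constant, and otherwise [p = F / a]. *)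
Lemma scaled_antiderivative (J : R -> Prop) (a : R) (f f' F : R -> R) :
  is_interval J -> (forall u, J u -> derivable_pt_lim f u (f' u)) ->
  (forall u, J u -> derivable_pt_lim F u (a * f u)) ->
  exists p k, (forall u, J u -> derivable_pt_lim p u (f u)) /\
    (forall u, J u -> F u = a * p u + k) /\ k * a = 0.
Proof.
intros HJ Hf HF; destruct (Req_dec a 0) as [-> | Ha].
- destruct (antiderivative_exists J f f' HJ Hf) as [p Hp].
  destruct (proj1 HJ) as [u0 Ju0].
  exists p, (F u0); split; [exact Hp | split; [|ring]].
  intros u Ju; rewrite Rmult_0_l, Rplus_0_l.
  apply (zero_derivative_constant J); auto.
  intros w Jw; eapply dlim_eq; [now apply HF | ring].
- exists (fun u => / a * F u), 0; split; [|split; [|ring]].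
  + intros u Ju; eapply dlim_eq; [dlim | cbv beta; now field].
  + intros u _; now field.
Qed.

(** * The geometric frame in coordinates and its explicit construction *)

Definition orthonormal4 (a b c d : V4) : Prop :=
  dot a a = 1 /\ dot b b = 1 /\ dot c c = 1 /\ dot d d = 1 /\
  dot a b = 0 /\ dot a c = 0 /\ dot a d = 0 /\
  dot b c = 0 /\ dot b d = 0 /\ dot c d = 0.

(** As [E = 1] and [sqrt G = g], the operators [nabla'_x] and [nabla'_y] are [d/du] and
    [g^(-1) d/dv], whence the factor [g] in all [v]-derivatives. The coefficients are already fixed
    as [gamma_1 = beta_1 = 0], [gamma_2 = ga], [beta_2 = be]. *)
Definition geometric_frame (D : dom2) (nu mu ga be g : R -> R)
    (z x y n1 n2 : R -> R -> V4) : Prop :=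
  Vpdu D z x /\ Vpdv D z (fun u v => vscal (g u) (y u v)) /\
  Vpdu D x (fun u v => vscal (nu u) (n1 u v)) /\
  Vpdv D x (fun u v => vadd (vscal (- (g u * ga u)) (y u v))
                            (vscal (g u * mu u) (n2 u v))) /\
  Vpdu D y (fun u v => vscal (mu u) (n2 u v)) /\
  Vpdv D y (fun u v => vadd (vscal (g u * ga u) (x u v))
                            (vscal (- (g u * nu u)) (n1 u v))) /\
  Vpdu D n1 (fun u v => vscal (- nu u) (x u v)) /\
  Vpdv D n1 (fun u v => vadd (vscal (g u * nu u) (y u v))
                             (vscal (g u * be u) (n2 u v))) /\
  Vpdu D n2 (fun u v => vscal (- mu u) (y u v)) /\
  Vpdv D n2 (fun u v => vadd (vscal (- (g u * mu u)) (x u v))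
                             (vscal (- (g u * be u)) (n1 u v))) /\
  (forall u v, D u v -> orthonormal4 (x u v) (y u v) (n1 u v) (n2 u v) /\
     det4 (x u v) (y u v) (n1 u v) (n2 u v) > 0).

Lemma geometric_frame_exists (J J' : R -> Prop) (nu mu ga be g : R -> R) :
  is_interval J -> smooth1 J nu -> smooth1 J mu ->
  invariants_system J nu mu ga be g ->
  exists z x y n1 n2,
    Vsmooth2 (fun u v => J u /\ J' v) z /\
    Vsmooth2 (fun u v => J u /\ J' v) n1 /\
    Vsmooth2 (fun u v => J u /\ J' v) n2 /\
    geometric_frame (fun u v => J u /\ J' v) nu mu ga be g z x y n1 n2.
Proof.
intros HJ Snu Smu Hinv.
destruct (rotation_angles J nu mu ga be g HJ Hinv) as (a & b & th & ph & Hth & Hph & Hab).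
destruct Hinv as (_ & _ & _ & _ & _ & _ & _ & Hg').
assert (Hcs : forall w, cos w * cos w = 1 - sin w * sin w).
{ intros w; generalize (sin2_cos2 w); unfold Rsqr; lra. }
(* The relations of [Hab] solved for [a] and [b] times a sine or cosine, by a rotation through [ph]
   in the first group and through [th] in the second. The first group serves the [v]-derivatives of
   [x] and [n1], the second those of [y] and [n2]. *)
assert (Hinvab : forall u, J u ->
  (a * cos (th u) = - (g u * ga u) * cos (ph u) - g u * mu u * sin (ph u) /\
   b * sin (th u) = - (g u * ga u) * sin (ph u) + g u * mu u * cos (ph u) /\
   a * sin (th u) = g u * be u * sin (ph u) - g u * nu u * cos (ph u) /\
   b * cos (th u) = g u * nu u * sin (ph u) + g u * be u * cos (ph u)) /\
  (a * cos (ph u) = - (g u * ga u) * cos (th u) - g u * nu u * sin (th u) /\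
   b * sin (ph u) = - (g u * ga u) * sin (th u) + g u * nu u * cos (th u) /\
   a * sin (ph u) = g u * be u * sin (th u) - g u * mu u * cos (th u) /\
   b * cos (ph u) = g u * mu u * sin (th u) + g u * be u * cos (th u))).
{ intros u Ju; destruct (Hab u Ju) as (E1 & E2 & E3 & E4).
  rewrite <- E1, <- E2, <- E3, <- E4.
  generalize (Hcs (th u)) (Hcs (ph u)); intros Eth Eph.
  repeat split; ring [Eth Eph]. }
(* In the first plane [z_u = x] asks for a radius [p] with [p' = cos th], while [z_v = g y] asks for
   [a * p = g * cos ph] up to the constant [k]; likewise [q] and [l] in the second plane. *)
destruct (scaled_antiderivative J a (fun u => cos (th u)) (fun u => - sin (th u) * nu u)
  (fun u => g u * cos (ph u)) HJ) as (p & k & Hp & Hpk & Hka).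
{ intros u Ju; dlim. }
{ intros u Ju; eapply dlim_eq; [dlim|].
  destruct (Hinvab u Ju) as ((E & _) & _); rewrite E; ring. }
destruct (scaled_antiderivative J b (fun u => sin (th u)) (fun u => cos (th u) * nu u)
  (fun u => g u * sin (ph u)) HJ) as (q & l & Hq & Hql & Hlb).
{ intros u Ju; dlim. }
{ intros u Ju; eapply dlim_eq; [dlim|].
  destruct (Hinvab u Ju) as ((_ & E & _) & _); rewrite E; ring. }
destruct (smooth1_cos_sin J nu th Snu Hth) as [Sct Sst].
destruct (smooth1_cos_sin J mu ph Smu Hph) as [Scp Ssp].
assert (Sp := smooth1_antiderivative J _ p Sct Hp).
assert (Sq := smooth1_antiderivative J _ q Sst Hq).
assert (Hlin : forall c v, J' v -> derivable_pt_lim (fun v => c * v) v c).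
{ intros c v _; eapply dlim_eq; [dlim | cbv beta; ring]. }
destruct (smooth1_cos_sin J' (fun _ => a) _ (smooth1_const J' a) (Hlin a)) as [Sca Ssa].
destruct (smooth1_cos_sin J' (fun _ => b) _ (smooth1_const J' b) (Hlin b)) as [Scb Ssb].
(* Either [k = 0] or [a = 0]. In the latter case the first plane does not turn, and the term [k * v]
   of the surface is a translation in its place. *)
assert (Hkcos : forall v, k * cos (a * v) = k /\ k * sin (a * v) = 0).
{ intros v; destruct (Rmult_integral _ _ Hka) as [-> | ->].
  - split; ring.
  - rewrite Rmult_0_l, cos_0, sin_0; split; ring. }
assert (Hlcos : forall v, l * cos (b * v) = l /\ l * sin (b * v) = 0).
{ intros v; destruct (Rmult_integral _ _ Hlb) as [-> | ->].
  - split; ring.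
  - rewrite Rmult_0_l, cos_0, sin_0; split; ring. }
(* The factor [1] in front of [k * v] and [l * v] presents these terms as separated products, in the
   form of [smooth2_mult_sep]. *)
exists
 (fun u v => mkV4 (p u * cos (a * v)) (p u * sin (a * v) + 1 * (k * v))
                  (q u * cos (b * v)) (q u * sin (b * v) + 1 * (l * v))),
 (fun u v => mkV4 (cos (th u) * cos (a * v)) (cos (th u) * sin (a * v))
                  (sin (th u) * cos (b * v)) (sin (th u) * sin (b * v))),
 (fun u v => mkV4 (- cos (ph u) * sin (a * v)) (cos (ph u) * cos (a * v))
                  (- sin (ph u) * sin (b * v)) (sin (ph u) * cos (b * v))),
 (fun u v => mkV4 (- sin (th u) * cos (a * v)) (- sin (th u) * sin (a * v))
                  (cos (th u) * cos (b * v)) (cos (th u) * sin (b * v))),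
 (fun u v => mkV4 (sin (ph u) * sin (a * v)) (- sin (ph u) * cos (a * v))
                  (- cos (ph u) * sin (b * v)) (cos (ph u) * cos (b * v))).
assert (Hsep := smooth2_mult_sep J J').
split; [|split; [|split]].
- assert (S1 := smooth1_const J 1).
  assert (Sk := smooth1_linear J' k); assert (Sl := smooth1_linear J' l).
  repeat split.
  + exact (Hsep _ _ Sp Sca).
  + exact (smooth2_plus _ _ _ (Hsep _ _ Sp Ssa) (Hsep _ _ S1 Sk)).
  + exact (Hsep _ _ Sq Scb).
  + exact (smooth2_plus _ _ _ (Hsep _ _ Sq Ssb) (Hsep _ _ S1 Sl)).
- assert (Smst := smooth1_opp J _ Sst).
  repeat split;
    [exact (Hsep _ _ Smst Sca) | exact (Hsep _ _ Smst Ssa)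
    | exact (Hsep _ _ Sct Scb) | exact (Hsep _ _ Sct Ssb)].
- assert (Smsp := smooth1_opp J _ Ssp); assert (Smcp := smooth1_opp J _ Scp).
  repeat split;
    [exact (Hsep _ _ Ssp Ssa) | exact (Hsep _ _ Smsp Sca)
    | exact (Hsep _ _ Smcp Ssb) | exact (Hsep _ _ Scp Scb)].
- repeat split;
    try (unfold comp0, comp1, comp2, comp3, vadd, vscal; cbn [c0 c1 c2 c3];
         intros u v [Ju Jv]; eapply dlim_eq; [dlim|]; cbv beta;
         destruct (Hinvab u Ju) as ((E1 & E2 & E3 & E4) & E5 & E6 & E7 & E8);
         generalize (Hpk u Ju) (Hql u Ju); intros Epk Eql;
         destruct (Hkcos v) as [Ek1 Ek2]; destruct (Hlcos v) as [El1 El2];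
         first [ ring | ring [E1] | ring [E2] | ring [E3] | ring [E4]
               | ring [E5] | ring [E6] | ring [E7] | ring [E8]
               | ring [Epk Ek1] | ring [Epk Ek2] | ring [Eql El1] | ring [Eql El2] ]);
    destruct H as [Ju Jv];
    generalize (Hcs (th u)) (Hcs (ph u)) (Hcs (a * v)) (Hcs (b * v));
    intros Et Ep Ea Eb.
  (* Ten of the remaining goals are the orthonormality relations; the eleventh is the orientation,
     where the determinant is 1. *)
  11: match goal with |- ?d > 0 => replace d with 1; [lra|] end.
  all: unfold dot, det4, det3; cbn [c0 c1 c2 c3]; ring [Et Ep Ea Eb].
Qed.

(** * Vector algebra, and the step from a geometric frame to a canonical surface *)

Lemma V4_ext (p q : V4) :
  c0 p = c0 q -> c1 p = c1 q -> c2 p = c2 q -> c3 p = c3 q -> p = q.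
Proof. destruct p, q; cbn; congruence. Qed.

Lemma dot_comm (p q : V4) : dot p q = dot q p.
Proof. unfold dot; ring. Qed.

Lemma dot_vadd_l (p q r : V4) : dot (vadd p q) r = dot p r + dot q r.
Proof. unfold dot, vadd; cbn [c0 c1 c2 c3]; ring. Qed.

Lemma dot_vscal_l (k : R) (p q : V4) : dot (vscal k p) q = k * dot p q.
Proof. unfold dot, vscal; cbn [c0 c1 c2 c3]; ring. Qed.

Lemma dot_vscal_r (k : R) (p q : V4) : dot p (vscal k q) = k * dot p q.
Proof. unfold dot, vscal; cbn [c0 c1 c2 c3]; ring. Qed.

Lemma vscal_1 (p : V4) : vscal 1 p = p.
Proof. apply V4_ext; cbn; ring. Qed.

Ltac vring := apply V4_ext; unfold vsub, vadd, vscal, vzero; cbn [c0 c1 c2 c3].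

(** Here [sigma(x,x) = nu n1], [sigma(x,y) = mu n2] and [sigma(y,y) = - nu n1], so the ellipse of
    curvature is centred at the origin with semi-axes [|nu|] along [n1] and [mu] along [n2]. *)
Lemma geometric_frame_canonical (J J' : R -> Prop) (nu mu ga be g : R -> R)
    (z x y n1 n2 : R -> R -> V4) :
  is_interval J -> is_interval J' ->
  invariants_system J nu mu ga be g ->
  Vsmooth2 (fun u v => J u /\ J' v) z ->
  Vsmooth2 (fun u v => J u /\ J' v) n1 ->
  Vsmooth2 (fun u v => J u /\ J' v) n2 ->
  geometric_frame (fun u v => J u /\ J' v) nu mu ga be g z x y n1 n2 ->
  canonical_surface J J' nu mu z.
Proof.
intros HJ HJ' (Hnd & Hgpos & Hgsq & Hnu & Hmu & Hga & Hbe & Hg') Sz Sn1 Sn2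
  (Hzu & Hzv & Hxu & Hxv & Hyu & Hyv & Hn1u & Hn1v & Hn2u & Hn2v & Hon).
do 2 eexists; exists x, y, n1, n2; do 8 eexists.
exists (fun _ _ => 0), (fun u _ => ga u), (fun _ _ => 0), (fun u _ => be u).
cbv zeta.
split; [exact Sz|]; split; [exact Hzu|]; split; [exact Hzv|].
split; [exact Sn1|]; split; [exact Sn2|].
split; [exact Hxu|]; split; [exact Hxv|]; split; [exact Hyu|]; split; [exact Hyv|].
split; [exact Hn1u|]; split; [exact Hn1v|]; split; [exact Hn2u|]; split; [exact Hn2v|].
assert (HE : forall u v, J u -> J' v -> dot (x u v) (x u v) = 1).
{ intros u v Ju Jv; apply (Hon u v (conj Ju Jv)). }
assert (HG : forall u v, J u -> J' v ->
  dot (vscal (g u) (y u v)) (vscal (g u) (y u v)) = g u * g u).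
{ intros u v Ju Jv; rewrite dot_vscal_l, dot_vscal_r.
  destruct (Hon u v (conj Ju Jv)) as ((_ & -> & _) & _); ring. }
split.
- intros u v [Ju Jv]; cbv beta.
  rewrite (HE u v Ju Jv), (HG u v Ju Jv).
  assert (Hgu := Hgpos u Ju).
  rewrite sqrt_1, Rinv_1, sqrt_square by lra.
  destruct (Hon u v (conj Ju Jv)) as
    ((Hxx & Hyy & Hn11 & Hn22 & Hxy & Hxn1 & Hxn2 & Hyn1 & Hyn2 & Hn12) & Hdet).
  destruct (Hnd u Ju) as (Hm & Hn & Hmn).
  assert (Hsxx : nproj (n1 u v) (n2 u v) (vscal 1 (vscal (nu u) (n1 u v))) =
                 vscal (nu u) (n1 u v)).
  { unfold nproj; rewrite !dot_vscal_l, Hn11, Hn12; vring; ring. }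
  assert (Hsxy : nproj (n1 u v) (n2 u v) (vscal 1 (vscal (mu u) (n2 u v))) =
                 vscal (mu u) (n2 u v)).
  { unfold nproj; rewrite !dot_vscal_l, (dot_comm (n2 u v) (n1 u v)), Hn22, Hn12.
    vring; ring. }
  assert (Hsyy : nproj (n1 u v) (n2 u v) (vscal (/ g u)
      (vadd (vscal (g u * ga u) (x u v)) (vscal (- (g u * nu u)) (n1 u v)))) =
      vscal (- nu u) (n1 u v)).
  { unfold nproj; rewrite !dot_vscal_l, !dot_vadd_l, !dot_vscal_l.
    rewrite Hn11, Hn12, Hxn1, Hxn2; vring; field; lra. }
  rewrite Hsxx, Hsxy, Hsyy.
  assert (Hd2 : forall A B, dot (vadd (vscal A (n1 u v)) (vscal B (n2 u v)))
                  (vadd (vscal A (n1 u v)) (vscal B (n2 u v))) = A * A + B * B).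
  { intros A B; rewrite !dot_vadd_l, !dot_vscal_l, !(dot_comm _ (vadd _ _)),
      !dot_vadd_l, !dot_vscal_l, (dot_comm (n2 u v) (n1 u v)), Hn11, Hn12, Hn22; ring. }
  (* This point is [nu cos(2t) n1 + mu sin(2t) n2], with the double angles written out. *)
  assert (Hell : forall t,
    vsub (vadd (vadd (vscal (cos t ^ 2) (vscal (nu u) (n1 u v)))
                     (vscal (2 * cos t * sin t) (vscal (mu u) (n2 u v))))
               (vscal (sin t ^ 2) (vscal (- nu u) (n1 u v))))
         (vscal (/ 2) (vadd (vscal (nu u) (n1 u v)) (vscal (- nu u) (n1 u v)))) =
    vadd (vscal (nu u * (cos t * cos t - sin t * sin t)) (n1 u v))
         (vscal (mu u * (2 * (cos t * sin t))) (n2 u v))).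
  { intros t; vring; field. }
  assert (Hx0 : vsub (vscal (nu u) (n1 u v))
         (vscal (/ 2) (vadd (vscal (nu u) (n1 u v)) (vscal (- nu u) (n1 u v)))) =
    vadd (vscal (nu u) (n1 u v)) (vscal 0 (n2 u v))).
  { vring; field. }
  assert (Hy0 : vsub (vscal (- nu u) (n1 u v))
         (vscal (/ 2) (vadd (vscal (nu u) (n1 u v)) (vscal (- nu u) (n1 u v)))) =
    vadd (vscal (- nu u) (n1 u v)) (vscal 0 (n2 u v))).
  { vring; field. }
  assert (Hunit : forall t, (cos t * cos t - sin t * sin t) * (cos t * cos t - sin t * sin t)
      + 2 * (cos t * sin t) * (2 * (cos t * sin t)) = 1).
  { intros t; transitivity ((Rsqr (sin t) + Rsqr (cos t)) ^ 2);
      [unfold Rsqr | rewrite sin2_cos2]; ring. }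
  repeat match goal with |- _ /\ _ => split end; try assumption; try reflexivity;
    try solve [vring; field; lra].
  + rewrite dot_vscal_r, Hxy; nra.
  + rewrite dot_vscal_r, Hxy; ring.
  + now apply Hgsq.
  (* The vertices on the [n1] axis are farthest from the centre if [mu^2 <= nu^2] and nearest
     otherwise; inserting [C^2 + S^2 = 1] lets the squared distances be compared term by term. *)
  + destruct (Rle_dec (mu u * mu u) (nu u * nu u)) as [Hle | Hle];
      [left | right]; intros t; rewrite Hell, Hx0, !Hd2; generalize (Hunit t);
      set (C := cos t * cos t - sin t * sin t); set (S := 2 * (cos t * sin t));
      intros HCS; replace (nu u * nu u) with (nu u * nu u * (C * C + S * S))
        by (rewrite HCS; ring); nra.
  + destruct (Rle_dec (mu u * mu u) (nu u * nu u)) as [Hle | Hle];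
      [left | right]; intros t; rewrite Hell, Hy0, !Hd2; generalize (Hunit t);
      set (C := cos t * cos t - sin t * sin t); set (S := 2 * (cos t * sin t));
      intros HCS; replace (- nu u * - nu u) with (nu u * nu u * (C * C + S * S))
        by (rewrite HCS; ring); nra.
(* Of the connection forms only [<x_v, y> = - g ga] and [<n1_v, n2> = g be] are nonconstant, with
   these [u]-derivatives. They give [K = - (nu^2 + mu^2)] and [kappa = 2 nu mu], hence
   [K^2 - kappa^2 = (mu^2 - nu^2)^2]. *)
- exists (fun _ _ => 0), (fun u _ => g u * (nu u ^ 2 + mu u ^ 2)),
    (fun _ _ => 0), (fun u _ => - (2 * g u * nu u * mu u)).
  split; [|split; [|split; [|split]]].
  + intros u v [Ju Jv]; apply (dlim_ext J' (fun _ => 0)); auto using dlim_cst.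
    intros t Jt; rewrite dot_vscal_l, dot_comm.
    destruct (Hon u t (conj Ju Jt)) as ((_ & _ & _ & _ & _ & _ & _ & -> & _) & _); ring.
  + intros u v [Ju Jv]; apply (dlim_ext J (fun s => - (g s * ga s))); auto.
    * intros s Js; rewrite dot_vadd_l, !dot_vscal_l, (dot_comm (n2 s v)).
      destruct (Hon s v (conj Js Jv)) as
        ((_ & -> & _ & _ & _ & _ & _ & _ & -> & _) & _); ring.
    * eapply dlim_eq; [dlim | cbv beta; ring].
  + intros u v [Ju Jv]; apply (dlim_ext J' (fun _ => 0)); auto using dlim_cst.
    intros t Jt; rewrite dot_vscal_l.
    destruct (Hon u t (conj Ju Jt)) as ((_ & _ & _ & _ & _ & _ & -> & _) & _); ring.
  + intros u v [Ju Jv]; apply (dlim_ext J (fun s => g s * be s)); auto.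
    * intros s Js; rewrite dot_vadd_l, !dot_vscal_l.
      destruct (Hon s v (conj Js Jv)) as
        ((_ & _ & _ & -> & _ & _ & _ & _ & -> & _) & _); ring.
    * eapply dlim_eq; [dlim | cbv beta; ring].
  + intros u v [Ju Jv]; rewrite (HE u v Ju Jv), (HG u v Ju Jv).
    assert (Hgu := Hgpos u Ju); destruct (Hnd u Ju) as (Hm & Hn & Hmn).
    rewrite Rmult_1_l, sqrt_square by lra.
    replace ((0 - g u * (nu u ^ 2 + mu u ^ 2)) / g u) with (- (nu u ^ 2 + mu u ^ 2))
      by (field; lra).
    replace ((0 - - (2 * g u * nu u * mu u)) / g u) with (2 * nu u * mu u)
      by (field; lra).
    split.
    * replace (_ - _) with ((mu u ^ 2 - nu u ^ 2) * (mu u ^ 2 - nu u ^ 2)) by ring.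
      assert (mu u ^ 2 - nu u ^ 2 <> 0) by lra; nra.
    * repeat apply Rmult_integral_contrapositive_currified; lra.
Qed.

(** * Orthonormal bases and orthogonal matrices *)

Definition lincomb (m a b c d : V4) : V4 :=
  vadd (vadd (vadd (vscal (c0 m) a) (vscal (c1 m) b)) (vscal (c2 m) c)) (vscal (c3 m) d).

(** For [p] a coordinate, this is a row of the transpose of the matrix with rows [a, b, c, d]. *)
Definition trow (p : V4 -> R) (a b c d : V4) : V4 := mkV4 (p a) (p b) (p c) (p d).

(** Associativity [p (M^T N) = (p M^T) N], where [M] and [N] have the rows [a, b, c, d] and
    [a', b', c', d']. *)
Lemma lincomb_lincomb (p a b c d a' b' c' d' : V4) :
  lincomb p (lincomb (trow c0 a b c d) a' b' c' d') (lincomb (trow c1 a b c d) a' b' c' d')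
    (lincomb (trow c2 a b c d) a' b' c' d') (lincomb (trow c3 a b c d) a' b' c' d') =
  lincomb (mkV4 (dot p a) (dot p b) (dot p c) (dot p d)) a' b' c' d'.
Proof.
apply V4_ext; cbn [lincomb trow vadd vscal dot c0 c1 c2 c3]; unfold dot; ring.
Qed.

Lemma det4_lincomb (m0 m1 m2 m3 a b c d : V4) :
  det4 (lincomb m0 a b c d) (lincomb m1 a b c d)
       (lincomb m2 a b c d) (lincomb m3 a b c d) =
  det4 m0 m1 m2 m3 * det4 a b c d.
Proof.
unfold lincomb, det4, det3, vadd, vscal; cbn [c0 c1 c2 c3]; ring.
Qed.

Lemma det4_transpose (a b c d : V4) :
  det4 (trow c0 a b c d) (trow c1 a b c d) (trow c2 a b c d) (trow c3 a b c d) =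
  det4 a b c d.
Proof.
unfold trow, det4, det3; cbn [c0 c1 c2 c3]; ring.
Qed.

(** The product is [det M * det M^T], the determinant of the Gram matrix, which is the identity. *)
Lemma orthonormal4_det (a b c d : V4) :
  orthonormal4 a b c d -> det4 a b c d * det4 a b c d = 1.
Proof.
intros (Haa & Hbb & Hcc & Hdd & Hab & Hac & Had & Hbc & Hbd & Hcd).
rewrite <- (det4_transpose a b c d) at 2; rewrite <- det4_lincomb.
assert (H : forall e, lincomb e (trow c0 a b c d) (trow c1 a b c d) (trow c2 a b c d)
    (trow c3 a b c d) = mkV4 (dot a e) (dot b e) (dot c e) (dot d e)).
{ intros e; apply V4_ext; unfold lincomb, trow, vadd, vscal, dot;
    cbn [c0 c1 c2 c3]; ring. }
rewrite !H, (dot_comm b a), (dot_comm c a), (dot_comm d a), (dot_comm c b),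
  (dot_comm d b), (dot_comm d c).
rewrite Haa, Hbb, Hcc, Hdd, Hab, Hac, Had, Hbc, Hbd, Hcd.
unfold det4, det3; cbn [c0 c1 c2 c3]; ring.
Qed.

Lemma dot_lincomb_r (e m a b c d : V4) :
  dot e (lincomb m a b c d) =
  c0 m * dot e a + c1 m * dot e b + c2 m * dot e c + c3 m * dot e d.
Proof. unfold lincomb, dot, vadd, vscal; cbn [c0 c1 c2 c3]; ring. Qed.

Lemma dot_lincomb (m m' a b c d : V4) :
  orthonormal4 a b c d -> dot (lincomb m a b c d) (lincomb m' a b c d) = dot m m'.
Proof.
intros (Haa & Hbb & Hcc & Hdd & Hab & Hac & Had & Hbc & Hbd & Hcd).
rewrite dot_lincomb_r, !(dot_comm (lincomb _ _ _ _ _)), !dot_lincomb_r.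
rewrite (dot_comm b a), (dot_comm c a), (dot_comm d a), (dot_comm c b),
  (dot_comm d b), (dot_comm d c).
rewrite Haa, Hbb, Hcc, Hdd, Hab, Hac, Had, Hbc, Hbd, Hcd.
unfold dot; ring.
Qed.

(* Cramer's rule *)
Lemma orthogonal_to_independent (e a b c d : V4) :
  det4 a b c d <> 0 -> dot e a = 0 -> dot e b = 0 -> dot e c = 0 -> dot e d = 0 ->
  e = vzero.
Proof.
intros Hdet Ha Hb Hc Hd.
apply V4_ext; cbn [vzero c0 c1 c2 c3];
  apply (Rmult_eq_reg_r (det4 a b c d)); trivial; rewrite Rmult_0_l.
- transitivity (det4 (mkV4 (dot e a) (c1 a) (c2 a) (c3 a))
    (mkV4 (dot e b) (c1 b) (c2 b) (c3 b)) (mkV4 (dot e c) (c1 c) (c2 c) (c3 c))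
    (mkV4 (dot e d) (c1 d) (c2 d) (c3 d))).
  + unfold det4, det3, dot; cbn [c0 c1 c2 c3]; ring.
  + rewrite Ha, Hb, Hc, Hd; unfold det4, det3; cbn [c0 c1 c2 c3]; ring.
- transitivity (det4 (mkV4 (c0 a) (dot e a) (c2 a) (c3 a))
    (mkV4 (c0 b) (dot e b) (c2 b) (c3 b)) (mkV4 (c0 c) (dot e c) (c2 c) (c3 c))
    (mkV4 (c0 d) (dot e d) (c2 d) (c3 d))).
  + unfold det4, det3, dot; cbn [c0 c1 c2 c3]; ring.
  + rewrite Ha, Hb, Hc, Hd; unfold det4, det3; cbn [c0 c1 c2 c3]; ring.
- transitivity (det4 (mkV4 (c0 a) (c1 a) (dot e a) (c3 a))
    (mkV4 (c0 b) (c1 b) (dot e b) (c3 b)) (mkV4 (c0 c) (c1 c) (dot e c) (c3 c))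
    (mkV4 (c0 d) (c1 d) (dot e d) (c3 d))).
  + unfold det4, det3, dot; cbn [c0 c1 c2 c3]; ring.
  + rewrite Ha, Hb, Hc, Hd; unfold det4, det3; cbn [c0 c1 c2 c3]; ring.
- transitivity (det4 (mkV4 (c0 a) (c1 a) (c2 a) (dot e a))
    (mkV4 (c0 b) (c1 b) (c2 b) (dot e b)) (mkV4 (c0 c) (c1 c) (c2 c) (dot e c))
    (mkV4 (c0 d) (c1 d) (c2 d) (dot e d))).
  + unfold det4, det3, dot; cbn [c0 c1 c2 c3]; ring.
  + rewrite Ha, Hb, Hc, Hd; unfold det4, det3; cbn [c0 c1 c2 c3]; ring.
Qed.

(** The remainder is orthogonal to all four basis vectors, which are independent because their
    determinant squares to 1. *)
Lemma orthonormal4_expansion (e a b c d : V4) :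
  orthonormal4 a b c d ->
  e = lincomb (mkV4 (dot e a) (dot e b) (dot e c) (dot e d)) a b c d.
Proof.
intros Hon.
assert (Hz : vsub e (lincomb (mkV4 (dot e a) (dot e b) (dot e c) (dot e d)) a b c d)
             = vzero).
{ assert (Hdet : det4 a b c d <> 0).
  { intros H; generalize (orthonormal4_det a b c d Hon); rewrite H; lra. }
  destruct Hon as (Haa & Hbb & Hcc & Hdd & Hab & Hac & Had & Hbc & Hbd & Hcd).
  apply (orthogonal_to_independent _ a b c d Hdet);
    unfold vsub; rewrite dot_vadd_l, dot_vscal_l, (dot_comm (lincomb _ _ _ _ _)),
      dot_lincomb_r; cbn [c0 c1 c2 c3];
    rewrite ?(dot_comm b a), ?(dot_comm c a), ?(dot_comm d a), ?(dot_comm c b),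
      ?(dot_comm d b), ?(dot_comm d c);
    rewrite ?Haa, ?Hbb, ?Hcc, ?Hdd, ?Hab, ?Hac, ?Had, ?Hbc, ?Hbd, ?Hcd; ring. }
revert Hz; generalize (lincomb (mkV4 (dot e a) (dot e b) (dot e c) (dot e d)) a b c d).
intros f Hf; injection Hf; intros; apply V4_ext; lra.
Qed.

(** Expanding the four standard basis vectors in the given basis yields [M^T M = 1] entry by
    entry. *)
Lemma orthonormal4_transpose (a b c d : V4) :
  orthonormal4 a b c d ->
  orthonormal4 (trow c0 a b c d) (trow c1 a b c d) (trow c2 a b c d) (trow c3 a b c d).
Proof.
intros Hon.
assert (H0 := orthonormal4_expansion (mkV4 1 0 0 0) a b c d Hon).
assert (H1 := orthonormal4_expansion (mkV4 0 1 0 0) a b c d Hon).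
assert (H2 := orthonormal4_expansion (mkV4 0 0 1 0) a b c d Hon).
assert (H3 := orthonormal4_expansion (mkV4 0 0 0 1) a b c d Hon).
unfold lincomb, vadd, vscal, dot in H0, H1, H2, H3; cbn [c0 c1 c2 c3] in H0, H1, H2, H3.
injection H0; injection H1; injection H2; injection H3; intros.
unfold orthonormal4, trow, dot; cbn [c0 c1 c2 c3]; repeat split; lra.
Qed.

(** * Congruence of surfaces whose frames solve the same linear system *)

(** The derivative formulas act on each coordinate of the ambient space separately; [x, y, n1, n2]
    here are one scalar coordinate of the four frame vectors. *)
Definition frame_coordinate (D : dom2) (nu mu ga be g : R -> R)
    (x y n1 n2 : R -> R -> R) : Prop :=
  pdu D x (fun u v => nu u * n1 u v) /\
  pdv D x (fun u v => - (g u * ga u) * y u v + g u * mu u * n2 u v) /\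
  pdu D y (fun u v => mu u * n2 u v) /\
  pdv D y (fun u v => g u * ga u * x u v + - (g u * nu u) * n1 u v) /\
  pdu D n1 (fun u v => - nu u * x u v) /\
  pdv D n1 (fun u v => g u * nu u * y u v + g u * be u * n2 u v) /\
  pdu D n2 (fun u v => - mu u * y u v) /\
  pdv D n2 (fun u v => - (g u * mu u) * x u v + - (g u * be u) * n1 u v).

Lemma geometric_frame_coordinates (D : dom2) (nu mu ga be g : R -> R)
    (z x y n1 n2 : R -> R -> V4) :
  geometric_frame D nu mu ga be g z x y n1 n2 ->
  frame_coordinate D nu mu ga be g (comp0 x) (comp0 y) (comp0 n1) (comp0 n2) /\
  frame_coordinate D nu mu ga be g (comp1 x) (comp1 y) (comp1 n1) (comp1 n2) /\
  frame_coordinate D nu mu ga be g (comp2 x) (comp2 y) (comp2 n1) (comp2 n2) /\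
  frame_coordinate D nu mu ga be g (comp3 x) (comp3 y) (comp3 n1) (comp3 n2).
Proof.
intros (_ & _ & Hxu & Hxv & Hyu & Hyv & Hn1u & Hn1v & Hn2u & Hn2v & _).
unfold Vpdu, Vpdv in *; unfold frame_coordinate.
repeat split;
  first [apply Hxu | apply Hxv | apply Hyu | apply Hyv
        | apply Hn1u | apply Hn1v | apply Hn2u | apply Hn2v].
Qed.

(* Both partial derivatives cancel because the coefficient matrices of the
   system are skew-symmetric. *)
Lemma frame_pairing_constant (J J' : R -> Prop) (nu mu ga be g : R -> R)
    (x y n1 n2 x' y' n1' n2' : R -> R -> R) :
  is_interval J -> is_interval J' ->
  frame_coordinate (fun u v => J u /\ J' v) nu mu ga be g x y n1 n2 ->
  frame_coordinate (fun u v => J u /\ J' v) nu mu ga be g x' y' n1' n2' ->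
  forall u v u' v', J u -> J' v -> J u' -> J' v' ->
  x' u v * x u v + y' u v * y u v + n1' u v * n1 u v + n2' u v * n2 u v =
  x' u' v' * x u' v' + y' u' v' * y u' v' + n1' u' v' * n1 u' v' + n2' u' v' * n2 u' v'.
Proof.
intros HJ HJ' (H1 & H2 & H3 & H4 & H5 & H6 & H7 & H8)
  (H1' & H2' & H3' & H4' & H5' & H6' & H7' & H8').
apply (zero_partials_constant J J' (fun u v =>
  x' u v * x u v + y' u v * y u v + n1' u v * n1 u v + n2' u v * n2 u v) HJ HJ').
- intros u v HD; eapply dlim_eq.
  + repeat apply dlim_plus; apply dlim_mult;
      first [ apply (H1' u v HD) | apply (H3' u v HD) | apply (H5' u v HD)
            | apply (H7' u v HD) | apply (H1 u v HD) | apply (H3 u v HD)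
            | apply (H5 u v HD) | apply (H7 u v HD) ].
  + cbv beta; ring.
- intros u v HD; eapply dlim_eq.
  + repeat apply dlim_plus; apply dlim_mult;
      first [ apply (H2' u v HD) | apply (H4' u v HD) | apply (H6' u v HD)
            | apply (H8' u v HD) | apply (H2 u v HD) | apply (H4 u v HD)
            | apply (H6 u v HD) | apply (H8 u v HD) ].
  + cbv beta; ring.
Qed.

Lemma geometric_frames_congruent (J J' : R -> Prop) (nu mu ga be g : R -> R)
    (z1 x1 y1 n1 m1 z2 x2 y2 n2 m2 : R -> R -> V4) :
  is_interval J -> is_interval J' ->
  geometric_frame (fun u v => J u /\ J' v) nu mu ga be g z1 x1 y1 n1 m1 ->
  geometric_frame (fun u v => J u /\ J' v) nu mu ga be g z2 x2 y2 n2 m2 ->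
  congruent (fun u v => J u /\ J' v) z1 z2.
Proof.
intros HJ HJ' HF1 HF2.
destruct (proj1 HJ) as [u0 Ju0]; destruct (proj1 HJ') as [v0 Jv0].
(* The images of the standard basis vectors under the map taking the first frame at [(u, v)] to the
   second. Each entry pairs a coordinate of one frame with a coordinate of the other, so it is
   constant by [frame_pairing_constant]. *)
pose (A := fun p u v => lincomb (trow p (x1 u v) (y1 u v) (n1 u v) (m1 u v))
                                (x2 u v) (y2 u v) (n2 u v) (m2 u v)).
assert (HA : forall u v, J u -> J' v ->
  A c0 u v = A c0 u0 v0 /\ A c1 u v = A c1 u0 v0 /\
  A c2 u v = A c2 u0 v0 /\ A c3 u v = A c3 u0 v0).
{ intros u v Ju Jv.
  destruct (geometric_frame_coordinates _ _ _ _ _ _ _ _ _ _ _ HF1) as (K0 & K1 & K2 & K3).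
  destruct (geometric_frame_coordinates _ _ _ _ _ _ _ _ _ _ _ HF2) as (L0 & L1 & L2 & L3).
  repeat split; apply V4_ext; unfold A, lincomb, trow, vadd, vscal; cbn [c0 c1 c2 c3];
    match goal with |- ?p (x1 _ _) * ?q (x2 _ _) + _ + _ + _ = _ =>
      apply (frame_pairing_constant J J' nu mu ga be g
        (fun u v => q (x2 u v)) (fun u v => q (y2 u v)) (fun u v => q (n2 u v))
        (fun u v => q (m2 u v)) (fun u v => p (x1 u v)) (fun u v => p (y1 u v))
        (fun u v => p (n1 u v)) (fun u v => p (m1 u v))); assumption
    end. }
destruct HF1 as (Hz1u & Hz1v & _ & _ & _ & _ & _ & _ & _ & _ & Hon1).
destruct HF2 as (Hz2u & Hz2v & _ & _ & _ & _ & _ & _ & _ & _ & Hon2).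
(* The constant orthogonal matrix with columns [A c_j] maps the first frame to the second. *)
assert (HO : forall u v p, J u -> J' v ->
  lincomb p (A c0 u0 v0) (A c1 u0 v0) (A c2 u0 v0) (A c3 u0 v0) =
  lincomb (mkV4 (dot p (x1 u v)) (dot p (y1 u v)) (dot p (n1 u v)) (dot p (m1 u v)))
    (x2 u v) (y2 u v) (n2 u v) (m2 u v)).
{ intros u v p Ju Jv; destruct (HA u v Ju Jv) as (<- & <- & <- & <-).
  apply lincomb_lincomb. }
destruct (Hon1 u0 v0 (conj Ju0 Jv0)) as [Hon01 Hdet1].
destruct (Hon2 u0 v0 (conj Ju0 Jv0)) as [Hon02 Hdet2].
assert (Ht := orthonormal4_transpose _ _ _ _ Hon01).
exists (A c0 u0 v0), (A c1 u0 v0), (A c2 u0 v0), (A c3 u0 v0).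
(* The translation is chosen to match the two surfaces at the base point. *)
exists (vsub (z2 u0 v0)
  (lincomb (z1 u0 v0) (A c0 u0 v0) (A c1 u0 v0) (A c2 u0 v0) (A c3 u0 v0))).
assert (HAon : orthonormal4 (A c0 u0 v0) (A c1 u0 v0) (A c2 u0 v0) (A c3 u0 v0)).
{ unfold orthonormal4, A; rewrite !(dot_lincomb _ _ _ _ _ _ Hon02); exact Ht. }
destruct HAon as (Haa & Hbb & Hcc & Hdd & Hab & Hac & Had & Hbc & Hbd & Hcd).
repeat (split; [assumption|]); split.
- unfold A; rewrite det4_lincomb, det4_transpose.
  generalize (orthonormal4_det _ _ _ _ Hon01) (orthonormal4_det _ _ _ _ Hon02).
  intros E1 E2.
  (* Each determinant is positive with square 1. *)
  replace (det4 (x1 u0 v0) (y1 u0 v0) (n1 u0 v0) (m1 u0 v0)) with 1 by nra.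
  replace (det4 (x2 u0 v0) (y2 u0 v0) (n2 u0 v0) (m2 u0 v0)) with 1 by nra.
  ring.
- intros u v [Ju Jv].
  change (z2 u v = vadd (lincomb (z1 u v) (A c0 u0 v0) (A c1 u0 v0) (A c2 u0 v0)
    (A c3 u0 v0)) (vsub (z2 u0 v0)
    (lincomb (z1 u0 v0) (A c0 u0 v0) (A c1 u0 v0) (A c2 u0 v0) (A c3 u0 v0)))).
  assert (HOx : forall u v, J u -> J' v ->
    lincomb (x1 u v) (A c0 u0 v0) (A c1 u0 v0) (A c2 u0 v0) (A c3 u0 v0) = x2 u v /\
    lincomb (y1 u v) (A c0 u0 v0) (A c1 u0 v0) (A c2 u0 v0) (A c3 u0 v0) = y2 u v).
  { clear u v Ju Jv; intros u v Ju Jv; rewrite !(HO u v _ Ju Jv).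
    destruct (Hon1 u v (conj Ju Jv)) as
      ((-> & -> & _ & _ & Exy & -> & -> & -> & -> & _) & _).
    rewrite (dot_comm (y1 u v)), Exy.
    split; apply V4_ext; unfold lincomb, vadd, vscal; cbn [c0 c1 c2 c3]; ring. }
  revert HOx; generalize (A c0 u0 v0) (A c1 u0 v0) (A c2 u0 v0) (A c3 u0 v0).
  intros a0 a1 a2 a3 HOx.
  unfold Vpdu, Vpdv, pdu, pdv, comp0, comp1, comp2, comp3 in *.
  destruct Hz1u as (U0 & U1 & U2 & U3); destruct Hz2u as (U0' & U1' & U2' & U3').
  destruct Hz1v as (W0 & W1 & W2 & W3); destruct Hz2v as (W0' & W1' & W2' & W3').
  (* The rotation takes [x1] to [x2] and [y1] to [y2], so every coordinate of [z2] minus the rotated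
     [z1] has vanishing partial derivatives. *)
  assert (Hcoord : forall p : V4 -> R,
    (forall q r, p (vadd q r) = p q + p r) -> (forall k q, p (vscal k q) = k * p q) ->
    (forall u v, J u /\ J' v ->
      derivable_pt_lim (fun s => p (z2 s v)) u (p (x2 u v))) ->
    (forall u v, J u /\ J' v ->
      derivable_pt_lim (fun t => p (z2 u t)) v (p (vscal (g u) (y2 u v)))) ->
    p (z2 u v) - p (lincomb (z1 u v) a0 a1 a2 a3) =
    p (z2 u0 v0) - p (lincomb (z1 u0 v0) a0 a1 a2 a3)).
  { intros p padd pscal Pu Pv.
    apply (zero_partials_constant J J'
      (fun u v => p (z2 u v) - p (lincomb (z1 u v) a0 a1 a2 a3)) HJ HJ'); auto.
    - intros s t HD; unfold lincomb.
      apply (dlim_ext J (fun s => p (z2 s t) - (c0 (z1 s t) * p a0 + c1 (z1 s t) * p a1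
        + c2 (z1 s t) * p a2 + c3 (z1 s t) * p a3))); [exact HJ | apply HD | |].
      + intros w _; rewrite !padd, !pscal; ring.
      + eapply dlim_eq; [dlim|]; cbv beta.
        destruct (HOx s t (proj1 HD) (proj2 HD)) as [<- _].
        unfold lincomb; rewrite !padd, !pscal; ring.
    - intros s t HD; unfold lincomb.
      apply (dlim_ext J' (fun t => p (z2 s t) - (c0 (z1 s t) * p a0 + c1 (z1 s t) * p a1
        + c2 (z1 s t) * p a2 + c3 (z1 s t) * p a3))); [exact HJ' | apply HD | |].
      + intros w _; rewrite !padd, !pscal; ring.
      + eapply dlim_eq; [dlim|]; cbv beta.
        destruct (HOx s t (proj1 HD) (proj2 HD)) as [_ <-].
        unfold lincomb; rewrite pscal, !padd, !pscal; cbn [vscal c0 c1 c2 c3]; ring. }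
  assert (E0 := Hcoord c0 (fun _ _ => eq_refl) (fun _ _ => eq_refl) U0' W0').
  assert (E1 := Hcoord c1 (fun _ _ => eq_refl) (fun _ _ => eq_refl) U1' W1').
  assert (E2 := Hcoord c2 (fun _ _ => eq_refl) (fun _ _ => eq_refl) U2' W2').
  assert (E3 := Hcoord c3 (fun _ _ => eq_refl) (fun _ _ => eq_refl) U3' W3').
  apply V4_ext; cbn [vsub vadd vscal c0 c1 c2 c3]; lra.
Qed.

(** * The connection coefficients of an arbitrary canonical surface *)

(* Compares the two expressions for [z_uv] and for [z_uuv] that the derivative
   formulas of the frame provide. *)
Lemma frame_integrability (J J' : R -> Prop) (nu mu ga be g : R -> R)
    (z zu zv x y xu xv yu n1 n2 n1v n2u ga2 be1 be2 : R -> R -> R) :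
  is_interval J -> is_interval J' ->
  invariants_system J nu mu ga be g ->
  let D := fun u v => J u /\ J' v in
  smooth2 D z -> pdu D z zu -> pdv D z zv ->
  pdu D x xu -> pdv D x xv -> pdu D y yu -> pdv D n1 n1v -> pdu D n2 n2u ->
  (forall u v, D u v ->
     x u v = zu u v /\ y u v = / g u * zv u v /\
     xu u v = nu u * n1 u v /\ yu u v = mu u * n2 u v /\
     / g u * xv u v = - ga2 u v * y u v + mu u * n2 u v /\
     / g u * n1v u v = nu u * y u v + be2 u v * n2 u v /\
     n2u u v = - mu u * y u v + - be1 u v * n1 u v) ->
  forall u v, D u v ->
    (ga2 u v - ga u) * y u v = 0 /\
    nu u * (be2 u v - be u) * n2 u v + mu u * be1 u v * n1 u v = 0.
Proof.
intros HJ HJ' (Hnd & Hgpos & _ & Hnu & Hmu & Hga & Hbe & Hg') D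
  [d [Hd0 Hd]] Hzu Hzv Hxu Hxv Hyu Hn1v Hn2u Heq.
(* The single family [d] of [smooth2] encodes the symmetry of mixed partials: [d 1 1] is both the
   [u]-derivative of [d 0 1] and the [v]-derivative of [d 1 0], and similarly for [d 2 1]. *)
assert (Hd10 : forall u v, J u -> J' v -> x u v = d 1%nat 0%nat u v).
{ intros u v Ju Jv; rewrite (proj1 (Heq u v (conj Ju Jv))); symmetry.
  apply (pdu_unique J J' (d 0%nat 0%nat) z); auto; [|apply Hd].
  intros; now apply Hd0. }
assert (Hd01 : forall u v, J u -> J' v -> d 0%nat 1%nat u v = g u * y u v).
{ intros u v Ju Jv; destruct (Heq u v (conj Ju Jv)) as (_ & -> & _).
  transitivity (zv u v); [|field; generalize (Hgpos u Ju); lra].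
  apply (pdv_unique J J' (d 0%nat 0%nat) z); auto; [|apply Hd].
  intros; now apply Hd0. }
assert (Hd20 : forall u v, J u -> J' v -> d 2%nat 0%nat u v = nu u * n1 u v).
{ intros u v Ju Jv; destruct (Heq u v (conj Ju Jv)) as (_ & _ & <- & _); symmetry.
  apply (pdu_unique J J' x (d 1%nat 0%nat)); auto; apply Hd. }
assert (Hd11 : forall u v, J u -> J' v ->
  d 1%nat 1%nat u v = g u * (mu u * n2 u v - ga u * y u v)).
{ apply (pdu_unique J J' (d 0%nat 1%nat) (fun u v => g u * y u v)); auto; [apply Hd|].
  intros u v HD; eapply dlim_eq.
  - apply dlim_mult; [apply Hg', HD | apply Hyu, HD].
  - destruct (Heq u v HD) as (_ & _ & _ & -> & _); cbv beta; ring. }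
assert (Hd11' : forall u v, J u -> J' v -> xv u v = d 1%nat 1%nat u v).
{ apply (pdv_unique J J' x (d 1%nat 0%nat)); auto; apply Hd. }
assert (Hd21 : forall u v, J u -> J' v -> d 2%nat 1%nat u v = nu u * n1v u v).
{ apply (pdv_unique J J' (d 2%nat 0%nat) (fun u v => nu u * n1 u v)); auto; [apply Hd|].
  intros u v HD; eapply dlim_eq.
  - apply dlim_mult; [apply dlim_cst | apply Hn1v, HD].
  - cbv beta; ring. }
assert (Hd21' : forall u v, J u -> J' v ->
  d 2%nat 1%nat u v =
  g u * (nu u * be u * n2 u v + nu u ^ 2 * y u v - mu u * be1 u v * n1 u v)).
{ apply (pdu_unique J J' (d 1%nat 1%nat)
    (fun u v => g u * (mu u * n2 u v - ga u * y u v))); auto; [apply Hd|].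
  intros u v HD; eapply dlim_eq.
  - destruct HD as [Ju Jv].
    apply dlim_mult; [now apply Hg'|].
    apply dlim_minus; apply dlim_mult;
      [now apply Hmu | now apply Hn2u | now apply Hga | now apply Hyu].
  - destruct (Heq u v HD) as (_ & _ & _ & -> & _ & _ & ->); cbv beta; ring. }
intros u v HD; destruct HD as [Ju Jv].
destruct (Heq u v (conj Ju Jv)) as (_ & _ & _ & _ & E1 & E2 & _).
assert (Hgu := Hgpos u Ju).
split.
- rewrite Hd11', Hd11 in E1 by assumption.
  replace (/ g u * (g u * (mu u * n2 u v - ga u * y u v)))
    with (mu u * n2 u v - ga u * y u v) in E1 by (field; lra).
  lra.
- assert (E3 := Hd21 u v Ju Jv); rewrite Hd21' in E3 by assumption.
  replace (n1v u v) with (g u * (nu u * y u v + be2 u v * n2 u v)) in E3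
    by (rewrite <- E2; field; lra).
  apply (Rmult_eq_reg_l (g u)); [|lra]; rewrite Rmult_0_r.
  lra.
Qed.

Lemma pdu_ext (D : dom2) (f h h' : R -> R -> R) :
  (forall u v, D u v -> h u v = h' u v) -> pdu D f h -> pdu D f h'.
Proof. intros E H u v HD; rewrite <- E by exact HD; now apply H. Qed.

Lemma pdv_ext (D : dom2) (f h h' : R -> R -> R) :
  (forall u v, D u v -> h u v = h' u v) -> pdv D f h -> pdv D f h'.
Proof. intros E H u v HD; rewrite <- E by exact HD; now apply H. Qed.

Lemma Vpdu_ext (D : dom2) (X Y Y' : R -> R -> V4) :
  (forall u v, D u v -> Y u v = Y' u v) -> Vpdu D X Y -> Vpdu D X Y'.
Proof.
intros E (H0 & H1 & H2 & H3); split; [|split; [|split]].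
- revert H0; apply pdu_ext; intros u v HD; unfold comp0; now rewrite E.
- revert H1; apply pdu_ext; intros u v HD; unfold comp1; now rewrite E.
- revert H2; apply pdu_ext; intros u v HD; unfold comp2; now rewrite E.
- revert H3; apply pdu_ext; intros u v HD; unfold comp3; now rewrite E.
Qed.

Lemma Vpdv_ext (D : dom2) (X Y Y' : R -> R -> V4) :
  (forall u v, D u v -> Y u v = Y' u v) -> Vpdv D X Y -> Vpdv D X Y'.
Proof.
intros E (H0 & H1 & H2 & H3); split; [|split; [|split]].
- revert H0; apply pdv_ext; intros u v HD; unfold comp0; now rewrite E.
- revert H1; apply pdv_ext; intros u v HD; unfold comp1; now rewrite E.
- revert H2; apply pdv_ext; intros u v HD; unfold comp2; now rewrite E.
- revert H3; apply pdv_ext; intros u v HD; unfold comp3; now rewrite E.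
Qed.

Lemma vscal_inv_eq (k : R) (p q : V4) : k <> 0 -> vscal (/ k) p = q -> p = vscal k q.
Proof. intros Hk <-; vring; now field. Qed.

(** The frame is the given one; what has to be shown is that its coefficients are those of
    [geometric_frame], which the integrability relations, taken in all four coordinates, enforce. *)
Lemma canonical_geometric_frame (J J' : R -> Prop) (nu mu ga be g : R -> R)
    (z : R -> R -> V4) :
  is_interval J -> is_interval J' ->
  invariants_system J nu mu ga be g ->
  canonical_surface J J' nu mu z ->
  exists x y n1 n2,
    geometric_frame (fun u v => J u /\ J' v) nu mu ga be g z x y n1 n2.
Proof.
intros HJ HJ' Hinv
  (zu & zv & x & y & n1 & n2 & xu & xv & yu & yv & n1u & n1v & n2u & n2v &
   ga1 & ga2 & be1 & be2 & Sz & Hzu & Hzv & _ & _ & Hxu & Hxv & Hyu & Hyv &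
   Hn1u & Hn1v & Hn2u & Hn2v & Hall & _).
cbv zeta beta in Hall.
assert (Hgpos : forall u, J u -> 0 < g u) by apply Hinv.
assert (Hgsq : forall u, J u -> g u * g u = / sqrt (Rabs (mu u ^ 2 - nu u ^ 2)))
  by apply Hinv.
(* The defining formulas with [E = 1], [sqrt G = g] and [gamma_1 = 0] inserted. *)
assert (Heq : forall u v, J u /\ J' v ->
  x u v = zu u v /\ y u v = vscal (/ g u) (zv u v) /\
  orthonormal4 (x u v) (y u v) (n1 u v) (n2 u v) /\
  det4 (x u v) (y u v) (n1 u v) (n2 u v) > 0 /\
  xu u v = vscal (nu u) (n1 u v) /\ yu u v = vscal (mu u) (n2 u v) /\
  vscal (/ g u) (xv u v) =
    vadd (vscal (- ga2 u v) (y u v)) (vscal (mu u) (n2 u v)) /\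
  vscal (/ g u) (yv u v) =
    vadd (vscal (ga2 u v) (x u v)) (vscal (- nu u) (n1 u v)) /\
  n1u u v = vadd (vscal (- nu u) (x u v)) (vscal (be1 u v) (n2 u v)) /\
  vscal (/ g u) (n1v u v) =
    vadd (vscal (nu u) (y u v)) (vscal (be2 u v) (n2 u v)) /\
  n2u u v = vadd (vscal (- mu u) (y u v)) (vscal (- be1 u v) (n1 u v)) /\
  vscal (/ g u) (n2v u v) =
    vadd (vscal (- mu u) (x u v)) (vscal (- be2 u v) (n1 u v))).
{ intros u v HD; generalize (Hall u v HD).
  intros (_ & _ & H1 & H2 & HE & HG & Hrest); revert H1 H2 Hrest.
  rewrite HE, HG, <- Hgsq by apply HD.
  rewrite sqrt_1, Rinv_1, sqrt_square by (apply Rlt_le, Hgpos, HD).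
  rewrite !vscal_1.
  intros Ex Ey (Hxx & Hyy & Hn11 & Hn22 & Hxy & Hxn1 & Hxn2 & Hyn1 & Hyn2 & Hn12 &
    Hdet & _ & _ & _ & Hga1 & E1 & E2 & E3 & E4 & E5 & E6 & E7 & E8 & _).
  rewrite Hga1 in E1, E2.
  repeat split; try assumption.
  - rewrite E1; vring; ring.
  - rewrite E2; vring; ring. }
assert (Hkey : forall u v, J u /\ J' v -> ga2 u v = ga u /\ be1 u v = 0 /\ be2 u v = be u).
{ intros u v HD.
  destruct Sz as (Sz0 & Sz1 & Sz2 & Sz3).
  destruct Hzu as (Hzu0 & Hzu1 & Hzu2 & Hzu3); destruct Hzv as (Hzv0 & Hzv1 & Hzv2 & Hzv3).
  destruct Hxu as (Hxu0 & Hxu1 & Hxu2 & Hxu3); destruct Hxv as (Hxv0 & Hxv1 & Hxv2 & Hxv3).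
  destruct Hyu as (Hyu0 & Hyu1 & Hyu2 & Hyu3).
  destruct Hn1v as (Hn1v0 & Hn1v1 & Hn1v2 & Hn1v3).
  destruct Hn2u as (Hn2u0 & Hn2u1 & Hn2u2 & Hn2u3).
  assert (I0 := frame_integrability J J' nu mu ga be g _ _ _ _ _ _ _ _ _ _ _ _ ga2 be1 be2
    HJ HJ' Hinv Sz0 Hzu0 Hzv0 Hxu0 Hxv0 Hyu0 Hn1v0 Hn2u0).
  assert (I1 := frame_integrability J J' nu mu ga be g _ _ _ _ _ _ _ _ _ _ _ _ ga2 be1 be2
    HJ HJ' Hinv Sz1 Hzu1 Hzv1 Hxu1 Hxv1 Hyu1 Hn1v1 Hn2u1).
  assert (I2 := frame_integrability J J' nu mu ga be g _ _ _ _ _ _ _ _ _ _ _ _ ga2 be1 be2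
    HJ HJ' Hinv Sz2 Hzu2 Hzv2 Hxu2 Hxv2 Hyu2 Hn1v2 Hn2u2).
  assert (I3 := frame_integrability J J' nu mu ga be g _ _ _ _ _ _ _ _ _ _ _ _ ga2 be1 be2
    HJ HJ' Hinv Sz3 Hzu3 Hzv3 Hxu3 Hxv3 Hyu3 Hn1v3 Hn2u3).
  unfold comp0, comp1, comp2, comp3 in I0, I1, I2, I3.
  assert (Heqp : forall p : V4 -> R,
    (forall q r, p (vadd q r) = p q + p r) -> (forall k q, p (vscal k q) = k * p q) ->
    forall u v, J u /\ J' v ->
    p (x u v) = p (zu u v) /\ p (y u v) = / g u * p (zv u v) /\
    p (xu u v) = nu u * p (n1 u v) /\ p (yu u v) = mu u * p (n2 u v) /\
    / g u * p (xv u v) = - ga2 u v * p (y u v) + mu u * p (n2 u v) /\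
    / g u * p (n1v u v) = nu u * p (y u v) + be2 u v * p (n2 u v) /\
    p (n2u u v) = - mu u * p (y u v) + - be1 u v * p (n1 u v)).
  { intros p padd pscal s t Hst; rewrite <- !pscal, <- !padd.
    destruct (Heq s t Hst) as
      (E1 & E2 & _ & _ & E3 & E4 & E5 & _ & _ & E6 & E7 & _).
    rewrite <- E2, E1, E3, E4, E5, E6, E7.
    repeat split; rewrite ?E1; reflexivity. }
  destruct (I0 (Heqp c0 (fun _ _ => eq_refl) (fun _ _ => eq_refl)) u v HD) as [A0 B0].
  destruct (I1 (Heqp c1 (fun _ _ => eq_refl) (fun _ _ => eq_refl)) u v HD) as [A1 B1].
  destruct (I2 (Heqp c2 (fun _ _ => eq_refl) (fun _ _ => eq_refl)) u v HD) as [A2 B2].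
  destruct (I3 (Heqp c3 (fun _ _ => eq_refl) (fun _ _ => eq_refl)) u v HD) as [A3 B3].
  assert (HA : vscal (ga2 u v - ga u) (y u v) = vzero) by (vring; assumption).
  assert (HB : vadd (vscal (nu u * (be2 u v - be u)) (n2 u v))
                    (vscal (mu u * be1 u v) (n1 u v)) = vzero) by (vring; assumption).
  destruct (Heq u v HD) as
    (_ & _ & (_ & Hyy & Hn11 & Hn22 & _ & _ & _ & _ & _ & Hn12) & _).
  destruct (proj1 Hinv u (proj1 HD)) as (Hm & Hn & _).
  assert (H0 : forall p, dot vzero p = 0) by (intros p; unfold dot; cbn; ring).
  (* Pairing with [y], [n1] and [n2] isolates the coefficients, from which the nonzero factors [mu]
     and [nu] can be cancelled. *)
  assert (C1 := f_equal (fun p => dot p (y u v)) HA).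
  assert (C2 := f_equal (fun p => dot p (n1 u v)) HB).
  assert (C3 := f_equal (fun p => dot p (n2 u v)) HB).
  cbv beta in C1, C2, C3.
  rewrite dot_vscal_l, H0, Hyy in C1.
  rewrite dot_vadd_l, !dot_vscal_l, H0, Hn11, (dot_comm (n2 u v)), Hn12 in C2.
  rewrite dot_vadd_l, !dot_vscal_l, H0, Hn22, Hn12 in C3.
  split; [lra|split].
  - destruct (Rmult_integral (mu u) (be1 u v)); lra.
  - destruct (Rmult_integral (nu u) (be2 u v - be u)); lra. }
exists x, y, n1, n2.
assert (Hg0 : forall u, J u -> g u <> 0)
  by (intros u Ju; generalize (Hgpos u Ju); lra).
split; [|split; [|split; [|split; [|split; [|split; [|split; [|split; [|split; [|split]]]]]]]]];
  [ revert Hzu; apply Vpdu_ext | revert Hzv; apply Vpdv_ext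
  | revert Hxu; apply Vpdu_ext | revert Hxv; apply Vpdv_ext
  | revert Hyu; apply Vpdu_ext | revert Hyv; apply Vpdv_ext
  | revert Hn1u; apply Vpdu_ext | revert Hn1v; apply Vpdv_ext
  | revert Hn2u; apply Vpdu_ext | revert Hn2v; apply Vpdv_ext | ];
  intros u v HD;
  destruct (Heq u v HD) as (E1 & E2 & Hon & Hdet & E3 & E4 & E5 & E6 & E7 & E8 & E9 & E10);
  destruct (Hkey u v HD) as (K1 & K2 & K3); rewrite ?K1, ?K2, ?K3 in *;
  assert (Hgu := Hg0 u (proj1 HD)).
- now symmetry.
- now apply vscal_inv_eq.
- exact E3.
- rewrite (vscal_inv_eq _ _ _ Hgu E5); vring; ring.
- exact E4.
- rewrite (vscal_inv_eq _ _ _ Hgu E6); vring; ring.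
- rewrite E7; vring; ring.
- rewrite (vscal_inv_eq _ _ _ Hgu E8); vring; ring.
- rewrite E9; vring; ring.
- rewrite (vscal_inv_eq _ _ _ Hgu E10); vring; ring.
- now split.
Qed.

(** * Existence and uniqueness of the surface from its invariants *)

Theorem theorem7p4 (J : R -> Prop) (nu mu : R -> R) :
  is_interval J -> smooth1 J nu -> smooth1 J mu ->
  (forall u, J u -> mu u > 0 /\ nu u <> 0 /\ mu u ^ 2 <> nu u ^ 2) ->
  (exists A1 B1 L1 L2 P1 P2 : R -> R, forall u, J u ->
     derivable_pt_lim (fun s => Rabs (mu s ^ 2 - nu s ^ 2)) u (A1 u) /\
     A1 u <> 0 /\
     derivable_pt_lim (fun s => Rabs ((mu s + nu s) / (mu s - nu s))) u (B1 u) /\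
     B1 u <> 0 /\
     derivable_pt_lim (fun s => ln (Rabs (mu s ^ 2 - nu s ^ 2))) u (L1 u) /\
     derivable_pt_lim L1 u (L2 u) /\
     derivable_pt_lim (fun s => ln (Rabs ((mu s + nu s) / (mu s - nu s)))) u (P1 u) /\
     derivable_pt_lim P1 u (P2 u) /\
     / 4 * L2 u - / 16 * L1 u ^ 2 + nu u ^ 2 + mu u ^ 2 = 0 /\
     / 2 * P2 u - / 8 * L1 u * P1 u + 2 * nu u * mu u = 0) ->
  exists J' : R -> Prop, is_interval J' /\
    (exists z : R -> R -> V4, canonical_surface J J' nu mu z) /\
    (forall z1 z2 : R -> R -> V4,
       canonical_surface J J' nu mu z1 -> canonical_surface J J' nu mu z2 ->
       congruent (fun u v => J u /\ J' v) z1 z2).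
Proof.
intros HJ Snu Smu Hnd (A1 & B1 & L1 & L2 & P1 & P2 & Hode).
destruct (invariants_system_exists J nu mu L1 L2 P1 P2 HJ Snu Smu Hnd)
  as (ga & be & g & Hinv).
{ intros u Ju; destruct (Hode u Ju) as (_ & _ & _ & _ & H); exact H. }
assert (HR : is_interval (fun _ => True)).
{ split; [now exists 0 | split; [trivial|]].
  intros x _; exists 1; split; [lra | trivial]. }
(* The one-parameter group that sweeps out the surface is defined for all times, so [v] may range
   over the whole line. *)
exists (fun _ => True); split; [exact HR | split].
- destruct (geometric_frame_exists J (fun _ => True) nu mu ga be g HJ Snu Smu Hinv)
    as (z & x & y & n1 & n2 & Sz & Sn1 & Sn2 & HF).
  exists z.
  exact (geometric_frame_canonical J _ nu mu ga be g z x y n1 n2 HJ HR Hinv Sz Sn1 Sn2 HF).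
- intros z1 z2 H1 H2.
  destruct (canonical_geometric_frame J _ nu mu ga be g z1 HJ HR Hinv H1)
    as (x1 & y1 & n1 & m1 & HF1).
  destruct (canonical_geometric_frame J _ nu mu ga be g z2 HJ HR Hinv H2)
    as (x2 & y2 & n2 & m2 & HF2).
  exact (geometric_frames_congruent J _ nu mu ga be g z1 x1 y1 n1 m1 z2 x2 y2 n2 m2
    HJ HR HF1 HF2).
Qed.
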